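(* Let $\mathsf{P}:\mathscr{C}^{\mathrm{op}}\to\mathsf{InfSL}$ be an existential biased elementary doctrine with weak full comprehensions and comprehensive diagonals. Then for every object $A\in\mathscr{C}$ $$\overline{\mathsf{P}_{/A}}\ \cong\ \overline{\mathsf{P}}_{/(A,\delta_{[A]})},$$ i.e. the quotient completion of the slice doctrine of $\mathsf{P}$ over $A$ is isomorphic, as a doctrine, to the slice doctrine over $(A,\delta_{[A]})$ of the quotient completion of $\mathsf{P}$.
   Context: **Weak products.** A weak product of objects $X_1,\dots,X_n$ is an object $W$ with arrows $\mathsf{p}_i:W\to X_i$ such that for all arrows $f_i:Z\to X_i$ there is a (not necessarily unique) $h:Z\to W$ with $\mathsf{p}_ih=f_i$ for all $i$. $\mathscr{C}$ has weak finite products if every finite list of objects has a weak product (the empty list giving a weak terminal object). **Biased primary doctrine.** $\mathsf{InfSL}$ is the category of posets with finite meets and finite-meet-preserving maps. A biased primary doctrine is a functor $\mathsf{P}:\mathscr{C}^{\mathrm{op}}\to\mathsf{InfSL}$ with $\mathscr{C}$ having weak finite products. For $f:X\to Y$ write $\mathsf{P}_f:\mathsf{P}(Y)\to\mathsf{P}(X)$; $\top_X$ is the top of $\mathsf{P}(X)$. **Biased elementary doctrine.** A biased primary doctrine with, for every object $X$ and every weak product $X\xleftarrow{\mathsf{p}_1}W\xrightarrow{\mathsf{p}_2}X$, a (fixed) element $\delta^{(\mathsf{p}_1,\mathsf{p}_2)}\in\mathsf{P}(W)$ such that: 1. for every $d:X\to W$ with $\mathsf{p}_1d=\mathsf{p}_2d=1_X$,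 $\top_X\le\mathsf{P}_d\delta^{(\mathsf{p}_1,\mathsf{p}_2)}$; 2. for every $\alpha\in\mathsf{P}(X)$, $\mathsf{P}_{\mathsf{p}_1}\alpha\wedge\delta^{(\mathsf{p}_1,\mathsf{p}_2)}\le\mathsf{P}_{\mathsf{p}_2}\alpha$; 3. for every weak product $X'\xleftarrow{\mathsf{p}'_1}W'\xrightarrow{\mathsf{p}'_2}X'$ and arrows $f:X'\to X$, $g:W'\to W$ with $\mathsf{p}_ig=f\mathsf{p}'_i$ ($i=1,2$), $\delta^{(\mathsf{p}'_1,\mathsf{p}'_2)}\le\mathsf{P}_g\delta^{(\mathsf{p}_1,\mathsf{p}_2)}$; 4. for every weak product $W\xleftarrow{\mathsf{r}_1}U\xrightarrow{\mathsf{r}_2}W$ and $t,t':U\to W$ with $\mathsf{p}_1t=\mathsf{p}_1\mathsf{r}_1$, $\mathsf{p}_2t=\mathsf{p}_1\mathsf{r}_2$, $\mathsf{p}_1t'=\mathsf{p}_2\mathsf{r}_1$, $\mathsf{p}_2t'=\mathsf{p}_2\mathsf{r}_2$: $\mathsf{P}_{\mathsf{r}_1}\delta^{(\mathsf{p}_1,\mathsf{p}_2)}\wedge\mathsf{P}_t\delta^{(\mathsf{p}_1,\mathsf{p}_2)}\wedge\mathsf{P}_{t'}\delta^{(\mathsf{p}_1,\mathsf{p}_2)}\le\mathsf{P}_{\mathsf{r}_2}\delta^{(\mathsf{p}_1,\mathsf{p}_2)}$. **Proof-irrelevant elements.** Let $\mathsf{p}_i:W\to X_i$, $1\le i\le n$,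 be a weak product. An element $\alpha\in\mathsf{P}(W)$ is proof-irrelevant if for some (equivalently, every) choice of weak products $W\xleftarrow{\mathsf{r}_1}U\xrightarrow{\mathsf{r}_2}W$, $X_i\xleftarrow{\mathsf{q}^i_1}W_i\xrightarrow{\mathsf{q}^i_2}X_i$ and arrows $t_i:U\to W_i$ with $\mathsf{q}^i_jt_i=\mathsf{p}_i\mathsf{r}_j$ ($j=1,2$) one has $\mathsf{P}_{\mathsf{r}_1}\alpha\wedge\bigwedge_{i}\mathsf{P}_{t_i}\delta^{(\mathsf{q}^i_1,\mathsf{q}^i_2)}\le\mathsf{P}_{\mathsf{r}_2}\alpha$. **Product completion and strictification.** $\mathscr{C}_s$ has as objects finite lists $[X_1,\dots,X_n]$ of objects of $\mathscr{C}$; an arrow $[X_1,\dots,X_n]\to[Y_1,\dots,Y_m]$ is a pair $(f,s)$ with $s:\{1,\dots,m\}\to\{1,\dots,n\}$ a function and $f=[f_1,\dots,f_m]$, $f_j:X_{s(j)}\to Y_j$. Finite products are list concatenation; $[f]:[X]\to[Y]$ is the arrow given by $f:X\to Y$. The strictification $\mathsf{P}^{s}:\mathscr{C}_s^{\mathrm{op}}\to\mathsf{InfSL}$: for a non-empty list, $\mathsf{P}^{s}[X_1,\dots,X_n]$ is the inf-semilattice of proof-irrelevant elements of weak products of $X_1,\dots,X_n$, where those of different weak products $W,W'$ are identified via the isomorphisms $\mathsf{P}_h$ for any $h:W\to W'$ commuting with projections (independent of $h$); $\mathsf{P}^{s}([\ ])=\{*\}$. In particular $\mathsf{P}^{s}[X]=\mathsf{P}(X)$.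 For an arrow $(f,s):[X_1,\dots,X_n]\to[Y_1,\dots,Y_m]$ of $\mathscr{C}_s$ (with $s:\{1,\dots,m\}\to\{1,\dots,n\}$ and $f=[f_1,\dots,f_m]$, $f_j:X_{s(j)}\to Y_j$) with $m\ge1$, $\mathsf{P}^{s}_{(f,s)}$ sends the class of $\alpha\in\mathsf{P}(V)$ ($\mathsf{p}'_j:V\to Y_j$ a weak product) to the class of $\mathsf{P}_g\alpha$, for any $g:W\to V$ with $\mathsf{p}'_jg=f_j\mathsf{p}_{s(j)}$, $\mathsf{p}_i:W\to X_i$ a weak product; $*$ is sent to the top. $\delta_{[X]}\in\mathsf{P}^{s}[X,X]$ is the class of the elements $\delta^{(\mathsf{p}_1,\mathsf{p}_2)}$. **Equivalence relations.** A $\mathsf{P}$-equivalence relation on $X\in\mathscr{C}$ is $\rho\in\mathsf{P}^{s}[X,X]$ with $\top\le\mathsf{P}^{s}_{\Delta_{[X]}}\rho$, $\mathsf{P}^{s}_{\langle p_2,p_1\rangle}\rho\le\rho$, $\mathsf{P}^{s}_{\langle p_1,p_2\rangle}\rho\wedge\mathsf{P}^{s}_{\langle p_2,p_3\rangle}\rho\le\mathsf{P}^{s}_{\langle p_1,p_3\rangle}\rho$; its descent data are $\mathrm{Des}_\rho=\{\alpha\in\mathsf{P}(X):\mathsf{P}^{s}_{p_1}\alpha\wedge\rho\le\mathsf{P}^{s}_{p_2}\alpha\}$. **Quotient completion.** Objects of $\overline{\mathscr{C}}$ are pairs $(X,\rho)$ with $\rho$ a $\mathsf{P}$-equivalence relation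 on $X\in\mathscr{C}$; arrows $(X,\rho)\to(Y,\sigma)$ are equivalence classes $\lfloor f\rceil$ of arrows $f:X\to Y$ with $\rho\le\mathsf{P}^{s}_{[f]\times[f]}\sigma$, where $f\sim f'$ iff $\rho\le\mathsf{P}^{s}_{[f]\times[f']}\sigma$. $\overline{\mathsf{P}}:\overline{\mathscr{C}}^{\mathrm{op}}\to\mathsf{InfSL}$ is $\overline{\mathsf{P}}(X,\rho)=\mathrm{Des}_\rho$, $\overline{\mathsf{P}}_{\lfloor f\rceil}=\mathsf{P}_f$. **Comprehensions and diagonals.** A weak comprehension of $\alpha\in\mathsf{P}(X)$ is $c:C\to X$ with $\top_C\le\mathsf{P}_c\alpha$ such that every $f:Y\to X$ with $\top_Y\le\mathsf{P}_f\alpha$ factors as $f=ch$ for some (not necessarily unique) $h$; it is full if $\alpha\le\beta$ whenever $\top_C\le\mathsf{P}_c\beta$. $\mathsf{P}$ has weak full comprehensions if every element of every fiber has one. $\mathsf{P}$ has comprehensive diagonals if for all $f,g:A\to X$: $f=g$ iff there exist a weak product $X\xleftarrow{\mathsf{p}_1}W\xrightarrow{\mathsf{p}_2}X$ and $h:A\to W$ with $\mathsf{p}_1h=f$, $\mathsf{p}_2h=g$, $\top_A\le\mathsf{P}_h\delta^{(\mathsf{p}_1,\mathsf{p}_2)}$. If $\mathsf{P}$ has both, $\mathscr{C}$ has weak pullbacks. **Existential.** $\mathsf{P}$ is existential if for every weak product $X_1\xleftarrow{\mathsf{p}_1}W\xrightarrow{\mathsf{p}_2}X_2$ the maps $\mathsf{P}_{\mathsf{p}_i}:\mathsf{P}(X_i)\to\mathsf{P}(W)$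 have left adjoints $\exists_{\mathsf{p}_i}$ satisfying: (weak Beck–Chevalley) for every $f:Y\to X_2$, weak product $X_1\xleftarrow{\mathsf{p}_1}V\xrightarrow{\mathsf{p}_2}Y$ and $f':V\to W$ with $\mathsf{p}_1f'=\mathsf{p}_1$, $\mathsf{p}_2f'=f\mathsf{p}_2$, one has $\exists_{\mathsf{p}_2}\mathsf{P}_{f'}\alpha=\mathsf{P}_f\exists_{\mathsf{p}_2}\alpha$ for all proof-irrelevant $\alpha\in\mathsf{P}(W)$, and analogously for $\mathsf{p}_1$; (weak Frobenius) $\exists_{\mathsf{p}_i}(\mathsf{P}_{\mathsf{p}_i}\alpha\wedge\beta)=\alpha\wedge\exists_{\mathsf{p}_i}\beta$ for $\alpha\in\mathsf{P}(X_i)$ and $\beta\in\mathsf{P}(W)$ proof-irrelevant. **Slice doctrine.** For a (biased) doctrine $Q:\mathscr{D}^{\mathrm{op}}\to\mathsf{InfSL}$ whose base has weak pullbacks and $B\in\mathscr{D}$, $Q_{/B}:(\mathscr{D}/B)^{\mathrm{op}}\to\mathsf{InfSL}$ sends $x:X\to B$ to $Q(X)$ and an arrow $h$ of $\mathscr{D}/B$ to $Q_h$. For $\mathsf{P}$ biased elementary, $\mathsf{P}_{/A}$ is biased elementary: for a weak product $x\xleftarrow{\pi_1}w\xrightarrow{\pi_2}x$ in $\mathscr{C}/A$, with $x:X\to A$ and $w:V\to A$, the element $\delta^{(\pi_1,\pi_2)}\in\mathsf{P}_{/A}(w)=\mathsf{P}(V)$ is $\mathsf{P}_k\delta^{(\mathsf{p}_1,\mathsf{p}_2)}$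 for any weak product $X\xleftarrow{\mathsf{p}_1}W\xrightarrow{\mathsf{p}_2}X$ in $\mathscr{C}$ and any $k:V\to W$ with $\mathsf{p}_ik=\pi_i$. **Isomorphism of doctrines.** An isomorphism $Q\cong Q'$ is an isomorphism $M$ of base categories together with a natural isomorphism $Q\cong Q'\circ M^{\mathrm{op}}$ of functors to $\mathsf{InfSL}$. *)

(* Defs.v *)
From HB Require Import structures.
From mathcomp Require Import all_boot all_order.
From mathcomp Require Import boolp generic_quotient.

Set Implicit Arguments.
Unset Strict Implicit.
Unset Printing Implicit Defensive.

Import Order.LTheory.
Local Open Scope order_scope.
Local Open Scope quotient_scope.

Record category := Category {
  obj :> Type;
  hom : obj -> obj -> Type;
  idm : forall X, hom X X;
  comp : forall X Y Z, hom Y Z -> hom X Y -> hom X Z;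
  comp1m : forall X Y (f : hom X Y), comp (idm Y) f = f;
  compm1 : forall X Y (f : hom X Y), comp f (idm X) = f;
  compA : forall X Y Z T (h : hom Z T) (g : hom Y Z) (f : hom X Y),
    comp h (comp g f) = comp (comp h g) f }.

Arguments idm {c} X.
Arguments comp {c X Y Z} g f.
Notation "g '\oc' f" := (comp g f) (at level 50, left associativity).

Record functor (C D : category) := Functor {
  fobj :> C -> D;
  fmap : forall X Y, hom X Y -> hom (fobj X) (fobj Y);
  fmap_id : forall X, fmap (idm X) = idm (fobj X);
  fmap_comp : forall X Y Z (g : hom Y Z) (f : hom X Y),
    fmap (g \oc f) = fmap g \oc fmap f }.

Arguments fmap {C D} _ {X Y} _.

Definition cat_iso (C D : category) (M : functor C D) : Prop :=
  bijective M /\ forall X Y : C, bijective (@fmap C D M X Y).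

Record wprod (C : category) n (X : 'I_n -> C) := WProd {
  wobj :> C;
  wproj : forall i, hom wobj (X i);
  wprodP : forall Z (f : forall i, hom Z (X i)),
    exists h : hom Z wobj, forall i, wproj i \oc h = f i }.

Arguments wproj {C n X} w i.

Definition has_weak_finite_products (C : category) : Prop :=
  forall n (X : 'I_n -> C), inhabited (wprod X).

Record wprod2 (C : category) (X1 X2 : C) := WProd2 {
  wobj2 :> C;
  wpr1 : hom wobj2 X1;
  wpr2 : hom wobj2 X2;
  wprod2P : forall Z (f1 : hom Z X1) (f2 : hom Z X2),
    exists h : hom Z wobj2, wpr1 \oc h = f1 /\ wpr2 \oc h = f2 }.

Arguments wpr1 {C X1 X2} w.
Arguments wpr2 {C X1 X2} w.

Definition pair_fam T (X1 X2 : T) (i : 'I_2) : T :=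
  match nat_of_ord i with 0 => X1 | _ => X2 end.

Definition pair_dfam T (F : T -> Type) (X1 X2 : T) (x1 : F X1) (x2 : F X2)
    (i : 'I_2) : F (pair_fam X1 X2 i) :=
  match nat_of_ord i as k
    return F (match k with 0 => X1 | _ => X2 end)
  with 0 => x1 | _ => x2 end.

Section WProdTheory.
Context (C : category).

Fact wprod_of2_subproof (X1 X2 : C) (w : wprod2 X1 X2) Z
    (f : forall i, hom Z (pair_fam X1 X2 i)) :
  exists h : hom Z w,
    forall i, pair_dfam (F := hom w) (wpr1 w) (wpr2 w) i \oc h = f i.
Proof.
have [h [h1 h2]] := wprod2P w (f ord0) (f ord_max).
exists h => i; case: i => [[|[|m]] lt_i] //=.
  by rewrite [Ordinal _](_ : _ = ord0) //; apply: val_inj.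
by rewrite [Ordinal _](_ : _ = ord_max) //; apply: val_inj.
Qed.

Definition wprod_of2 (X1 X2 : C) (w : wprod2 X1 X2) : wprod (pair_fam X1 X2) :=
  WProd (wprod_of2_subproof w).

Fact wprod2_of_subproof (X1 X2 : C) (w : wprod (pair_fam X1 X2)) Z
    (f1 : hom Z X1) (f2 : hom Z X2) :
  exists h : hom Z w, (wproj w ord0 : hom w X1) \oc h = f1 /\
                      (wproj w ord_max : hom w X2) \oc h = f2.
Proof.
have [h hE] := wprodP w (pair_dfam (F := hom Z) f1 f2).
by exists h; split; [exact: (hE ord0) | exact: (hE ord_max)].
Qed.

Definition wprod2_of (X1 X2 : C) (w : wprod (pair_fam X1 X2)) : wprod2 X1 X2 :=
  WProd2 (@wprod2_of_subproof X1 X2 w).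

Fact wsquare_of_subproof (X : C) (w : wprod (fun _ : 'I_2 => X)) Z
    (f1 f2 : hom Z X) :
  exists h : hom Z w, wproj w ord0 \oc h = f1 /\ wproj w ord_max \oc h = f2.
Proof.
have [h hE] := wprodP w (fun i : 'I_2 => if i == ord0 then f1 else f2).
by exists h; rewrite !hE.
Qed.

Definition wsquare_of (X : C) (w : wprod (fun _ : 'I_2 => X)) : wprod2 X X :=
  WProd2 (@wsquare_of_subproof X w).

Definition id_wprod (X : C) : wprod (fun _ : 'I_1 => X).
Proof.
exists X (fun=> idm X) => Z f; exists (f ord0) => i.
by rewrite (ord1 i) comp1m.
Defined.

Definition wlift n (X : 'I_n -> C) (w : wprod X) Z
  (f : forall i, hom Z (X i)) : hom Z w := sval (cid (wprodP w f)).

Lemma wliftE n (X : 'I_n -> C) (w : wprod X) Z (f : forall i, hom Z (X i)) i :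
  wproj w i \oc wlift w f = f i.
Proof. exact: (svalP (cid (wprodP w f))). Qed.

Definition wlift2 (X1 X2 : C) (w : wprod2 X1 X2) Z
  (f1 : hom Z X1) (f2 : hom Z X2) : hom Z w := sval (cid (wprod2P w f1 f2)).

Lemma wlift2_1 (X1 X2 : C) (w : wprod2 X1 X2) Z
  (f1 : hom Z X1) (f2 : hom Z X2) : wpr1 w \oc wlift2 w f1 f2 = f1.
Proof. by case: (svalP (cid (wprod2P w f1 f2))). Qed.

Lemma wlift2_2 (X1 X2 : C) (w : wprod2 X1 X2) Z
  (f1 : hom Z X1) (f2 : hom Z X2) : wpr2 w \oc wlift2 w f1 f2 = f2.
Proof. by case: (svalP (cid (wprod2P w f1 f2))). Qed.

Context (HC : has_weak_finite_products C).

Fact some_wprod_subproof n (X : 'I_n -> C) : exists w : wprod X, True.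
Proof. by case: (HC X) => w; exists w. Qed.

Definition some_wprod n (X : 'I_n -> C) : wprod X :=
  sval (cid (some_wprod_subproof X)).

Definition some_wprod2 (X1 X2 : C) : wprod2 X1 X2 :=
  wprod2_of (some_wprod (pair_fam X1 X2)).

End WProdTheory.

Definition has_weak_pullbacks (C : category) : Prop :=
  forall (X Y A : C) (f : hom X A) (g : hom Y A),
    exists (V : C) (p : hom V X) (q : hom V Y), f \oc p = g \oc q /\
      forall Z (a : hom Z X) (b : hom Z Y), f \oc a = g \oc b ->
        exists h : hom Z V, p \oc h = a /\ q \oc h = b.

(* The display only selects the generic order notations. *)
Notation infsl := (tMeetSemilatticeType (Order.Disp tt tt)).

Record doctrine (C : category) := Doctrine {
  fib :> C -> infsl;
  reindex : forall X Y, hom X Y -> fib Y -> fib X;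
  reindexT : forall X Y (f : hom X Y), reindex f \top = \top;
  reindexI : forall X Y (f : hom X Y) (a b : fib Y),
    reindex f (a `&` b) = reindex f a `&` reindex f b;
  reindex_id : forall X (a : fib X), reindex (idm X) a = a;
  reindex_comp : forall X Y Z (g : hom Y Z) (f : hom X Y) (a : fib Z),
    reindex (g \oc f) a = reindex f (reindex g a) }.

Arguments reindex {C} d {X Y} f a.
Notation "f *^ a" := (reindex _ f a) (at level 30, right associativity).

Definition infsl_iso (L M : infsl) (phi : L -> M) : Prop :=
  [/\ bijective phi, phi \top = \top &
      forall a b, phi (a `&` b) = phi a `&` phi b].

Definition doctrine_iso (C D : category) (P : doctrine C) (Q : doctrine D) :
    Prop :=
  exists (M : functor C D) (phi : forall X : C, P X -> Q (M X)),
    [/\ cat_iso M,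
        forall X, infsl_iso (phi X) &
        forall (X Y : C) (f : hom X Y) (a : P Y),
          phi X (f *^ a) = fmap M f *^ phi Y a].

Record biased_elementary (C : category) (P : doctrine C) := BiasedElementary {
  be_wfp : has_weak_finite_products C;
  delta : forall (X : C) (w : wprod2 X X), P w;
  delta_refl : forall (X : C) (w : wprod2 X X) (d : hom X w),
    wpr1 w \oc d = idm X -> wpr2 w \oc d = idm X -> \top <= d *^ delta w;
  delta_subst : forall (X : C) (w : wprod2 X X) (a : P X),
    wpr1 w *^ a `&` delta w <= wpr2 w *^ a;
  delta_nat : forall (X X' : C) (w : wprod2 X X) (w' : wprod2 X' X')
      (f : hom X' X) (g : hom w' w),
    wpr1 w \oc g = f \oc wpr1 w' -> wpr2 w \oc g = f \oc wpr2 w' ->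
    delta w' <= g *^ delta w;
  delta_pi : forall (X : C) (w : wprod2 X X) (u : wprod2 w w) (t t' : hom u w),
    wpr1 w \oc t = wpr1 w \oc wpr1 u -> wpr2 w \oc t = wpr1 w \oc wpr2 u ->
    wpr1 w \oc t' = wpr2 w \oc wpr1 u -> wpr2 w \oc t' = wpr2 w \oc wpr2 u ->
    wpr1 u *^ delta w `&` t *^ delta w `&` t' *^ delta w
      <= wpr2 u *^ delta w }.

Definition proof_irrelevant (C : category) (P : doctrine C)
    (E : biased_elementary P) n (X : 'I_n -> C) (w : wprod X) (a : P w) : Prop :=
  exists (u : wprod2 w w) (v : forall i, wprod2 (X i) (X i))
         (t : forall i, hom u (v i)),
    (forall i, wpr1 (v i) \oc t i = wproj w i \oc wpr1 u /\
               wpr2 (v i) \oc t i = wproj w i \oc wpr2 u) /\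
    wpr1 u *^ a `&` \meet_(i < n) (t i *^ delta E (v i)) <= wpr2 u *^ a.

Definition proof_irrelevant2 (C : category) (P : doctrine C)
    (E : biased_elementary P) (X1 X2 : C) (w : wprod2 X1 X2) (a : P w) : Prop :=
  proof_irrelevant E (w := wprod_of2 w) a.

Definition weak_comprehension (C : category) (P : doctrine C) (X : C) (a : P X)
    (K : C) (c : hom K X) : Prop :=
  \top <= c *^ a /\
  forall (Y : C) (f : hom Y X), \top <= f *^ a ->
    exists h : hom Y K, f = c \oc h.

Definition full_comprehension (C : category) (P : doctrine C) (X : C) (a : P X)
    (K : C) (c : hom K X) : Prop :=
  forall b : P X, \top <= c *^ b -> a <= b.

Definition weak_full_comprehensions (C : category) (P : doctrine C) : Prop :=
  forall (X : C) (a : P X), exists (K : C) (c : hom K X),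
    weak_comprehension a c /\ full_comprehension a c.

Definition comprehensive_diagonals (C : category) (P : doctrine C)
    (E : biased_elementary P) : Prop :=
  forall (A X : C) (f g : hom A X),
    f = g <-> exists (w : wprod2 X X) (h : hom A w),
      [/\ wpr1 w \oc h = f, wpr2 w \oc h = g & \top <= h *^ delta E w].

Record existential_with (C : category) (P : doctrine C)
    (E : biased_elementary P)
    (ex1 : forall (X1 X2 : C) (w : wprod2 X1 X2), P w -> P X1)
    (ex2 : forall (X1 X2 : C) (w : wprod2 X1 X2), P w -> P X2) : Prop := {
  ex1_adj : forall (X1 X2 : C) (w : wprod2 X1 X2) (b : P w) (a : P X1),
    ex1 _ _ w b <= a <-> b <= wpr1 w *^ a;
  ex2_adj : forall (X1 X2 : C) (w : wprod2 X1 X2) (b : P w) (a : P X2),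
    ex2 _ _ w b <= a <-> b <= wpr2 w *^ a;
  ex1_BC : forall (X1 X2 Y : C) (w : wprod2 X1 X2) (f : hom Y X1)
      (v : wprod2 Y X2) (f' : hom v w) (a : P w),
    wpr1 w \oc f' = f \oc wpr1 v -> wpr2 w \oc f' = wpr2 v ->
    proof_irrelevant2 E a -> ex1 _ _ v (f' *^ a) = f *^ ex1 _ _ w a;
  ex2_BC : forall (X1 X2 Y : C) (w : wprod2 X1 X2) (f : hom Y X2)
      (v : wprod2 X1 Y) (f' : hom v w) (a : P w),
    wpr1 w \oc f' = wpr1 v -> wpr2 w \oc f' = f \oc wpr2 v ->
    proof_irrelevant2 E a -> ex2 _ _ v (f' *^ a) = f *^ ex2 _ _ w a;
  ex1_Frob : forall (X1 X2 : C) (w : wprod2 X1 X2) (a : P X1) (b : P w),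
    proof_irrelevant2 E b ->
    ex1 _ _ w (wpr1 w *^ a `&` b) = a `&` ex1 _ _ w b;
  ex2_Frob : forall (X1 X2 : C) (w : wprod2 X1 X2) (a : P X2) (b : P w),
    proof_irrelevant2 E b ->
    ex2 _ _ w (wpr2 w *^ a `&` b) = a `&` ex2 _ _ w b }.

Definition existential (C : category) (P : doctrine C)
    (E : biased_elementary P) : Prop :=
  exists ex1 ex2, existential_with E ex1 ex2.

Section OrderFacts.
Context (C : category) (P : doctrine C).

Lemma reindex_le X Y (f : hom X Y) (a b : P Y) : a <= b -> f *^ a <= f *^ b.
Proof. by rewrite !leEmeet -reindexI => /eqP ->. Qed.

Lemma reindex_meets X Y (f : hom X Y) n (F : 'I_n -> P Y) :
  f *^ (\meet_(i < n) F i) = \meet_(i < n) (f *^ F i).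
Proof. exact: (big_morph _ (reindexI f) (reindexT P f)). Qed.

End OrderFacts.

Section EqElement.
Context (C : category) (P : doctrine C) (E : biased_elementary P).

(* The reindexing of delta along a lift of (f, g); by eq_eltE it depends
   neither on the weak product nor on the lift. *)
Definition eq_elt (Z X : C) (f g : hom Z X) : P Z :=
  let w := some_wprod2 (be_wfp E) X X in wlift2 w f g *^ delta E w.

Lemma delta_par_refl (Z X : C) (w : wprod2 X X) (m : hom Z w) :
  wpr1 w \oc m = wpr2 w \oc m -> \top <= m *^ delta E w.
Proof.
move=> m12; set e := wpr1 w \oc m.
pose wZ := some_wprod2 (be_wfp E) Z Z.
pose u := some_wprod2 (be_wfp E) w w.
pose s : hom X w := wlift2 w (idm X) (idm X).
pose d : hom Z wZ := wlift2 wZ (idm Z) (idm Z).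
pose y : hom wZ u := wlift2 u (s \oc e \oc wpr1 wZ) (m \oc wpr2 wZ).
pose t : hom u w := wlift2 w (wpr1 w \oc wpr1 u) (wpr1 w \oc wpr2 u).
pose t' : hom u w := wlift2 w (wpr2 w \oc wpr1 u) (wpr2 w \oc wpr2 u).
have dT : \top <= d *^ delta E wZ.
  by apply: delta_refl; rewrite ?wlift2_1 ?wlift2_2.
have s1 : wpr1 w \oc s = idm X by rewrite wlift2_1.
have s2 : wpr2 w \oc s = idm X by rewrite wlift2_2.
have y1 : wpr1 u \oc y = s \oc e \oc wpr1 wZ by rewrite wlift2_1.
have y2 : wpr2 u \oc y = m \oc wpr2 wZ by rewrite wlift2_2.
have key (q : hom w X) (r : hom u w) : q \oc s = idm X -> q \oc m = e ->
    wpr1 w \oc r = q \oc wpr1 u -> wpr2 w \oc r = q \oc wpr2 u ->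
    \top <= (y \oc d) *^ (r *^ delta E w).
  move=> qs qm r1 r2; rewrite -reindex_comp compA reindex_comp.
  apply: (le_trans dT); apply: reindex_le; apply: (@delta_nat _ _ E _ _ _ _ (e)).
    by rewrite compA r1 -compA y1 !compA qs comp1m.
  by rewrite compA r2 -compA y2 !compA qm.
have := delta_pi E (w := w) (u := u) (t := t) (t' := t').
rewrite /t /t' !wlift2_1 !wlift2_2 -/t -/t' => /(_ erefl erefl erefl erefl).
move/(reindex_le (y \oc d)); rewrite !reindexI.
have -> : (y \oc d) *^ (wpr2 u *^ delta E w) = m *^ delta E w.
  by rewrite -reindex_comp compA y2 -compA wlift2_2 compm1.
apply: le_trans; rewrite !lexI; apply/andP; split; first (apply/andP; split).
- rewrite -reindex_comp compA y1 -compA wlift2_1 compm1 reindex_comp.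
  by rewrite -(reindexT P e); apply: reindex_le; apply: delta_refl.
- by apply: (key (wpr1 w)); rewrite ?wlift2_1 ?wlift2_2.
- by apply: (key (wpr2 w)); rewrite ?wlift2_1 ?wlift2_2.
Qed.

Lemma delta_par (Z X : C) (w : wprod2 X X) (h k : hom Z w) :
  wpr1 w \oc h = wpr1 w \oc k -> wpr2 w \oc h = wpr2 w \oc k ->
  h *^ delta E w <= k *^ delta E w.
Proof.
move=> hk1 hk2.
pose u := some_wprod2 (be_wfp E) w w.
pose t : hom u w := wlift2 w (wpr1 w \oc wpr1 u) (wpr1 w \oc wpr2 u).
pose t' : hom u w := wlift2 w (wpr2 w \oc wpr1 u) (wpr2 w \oc wpr2 u).
pose y : hom Z u := wlift2 u h k.
have y1 : wpr1 u \oc y = h by rewrite wlift2_1.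
have y2 : wpr2 u \oc y = k by rewrite wlift2_2.
have := delta_pi E (w := w) (u := u) (t := t) (t' := t').
rewrite /t /t' !wlift2_1 !wlift2_2 -/t -/t' => /(_ erefl erefl erefl erefl).
move/(reindex_le y); rewrite !reindexI -!reindex_comp y1 y2; apply: le_trans.
rewrite !lexI lexx /= -[h *^ _]meetx1; apply/andP; split.
  apply: leIxr; apply: delta_par_refl.
  by rewrite !compA wlift2_1 wlift2_2 -!compA y1 y2.
apply: leIxr; apply: delta_par_refl.
by rewrite !compA wlift2_1 wlift2_2 -!compA y1 y2.
Qed.

Lemma eq_eltE (Z X : C) (w : wprod2 X X) (h : hom Z w) :
  h *^ delta E w = eq_elt (wpr1 w \oc h) (wpr2 w \oc h).
Proof.
rewrite /eq_elt; set w0 := some_wprod2 _ _ _; set k := wlift2 w0 _ _.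
have le (v v' : wprod2 X X) (a : hom Z v) (b : hom Z v') :
    wpr1 v \oc a = wpr1 v' \oc b -> wpr2 v \oc a = wpr2 v' \oc b ->
    a *^ delta E v <= b *^ delta E v'.
  move=> ab1 ab2; pose g := wlift2 v' (wpr1 v) (wpr2 v).
  have g1 : wpr1 v' \oc g = wpr1 v by rewrite wlift2_1.
  have g2 : wpr2 v' \oc g = wpr2 v by rewrite wlift2_2.
  apply: (@le_trans _ _ (a *^ (g *^ delta E v'))).
    apply: reindex_le; apply: (@delta_nat _ _ E _ _ _ _ (idm X)).
      by rewrite comp1m.
    by rewrite comp1m.
  by rewrite -reindex_comp; apply: delta_par; rewrite compA ?g1 ?g2.
by apply/eqP; rewrite eq_le !le // ?wlift2_1 ?wlift2_2.
Qed.

Lemma eq_elt_refl (Z X : C) (f : hom Z X) : eq_elt f f = \top.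
Proof.
apply/eqP; rewrite eq_le lex1 /=; apply: delta_par_refl.
by rewrite wlift2_1 wlift2_2.
Qed.

Lemma eq_elt_reindex (Y Z X : C) (k : hom Y Z) (f g : hom Z X) :
  k *^ eq_elt f g = eq_elt (f \oc k) (g \oc k).
Proof.
by rewrite {1}/eq_elt -reindex_comp eq_eltE !compA wlift2_1 wlift2_2.
Qed.

Lemma eq_elt_map (Z X Y : C) (k : hom X Y) (f g : hom Z X) :
  eq_elt f g <= eq_elt (k \oc f) (k \oc g).
Proof.
rewrite {1}/eq_elt; set w := some_wprod2 _ _ _.
pose v := some_wprod2 (be_wfp E) Y Y.
pose r := wlift2 v (k \oc wpr1 w) (k \oc wpr2 w).
apply: (@le_trans _ _ (wlift2 w f g *^ (r *^ delta E v))).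
  by apply: reindex_le; apply: (@delta_nat _ _ E _ _ _ _ (k)); rewrite ?wlift2_1 ?wlift2_2.
rewrite -reindex_comp eq_eltE !compA /r !wlift2_1 !wlift2_2.
by rewrite -!compA wlift2_1 wlift2_2.
Qed.

Lemma eq_elt_subst (Z X : C) (f g : hom Z X) (a : P X) :
  f *^ a `&` eq_elt f g <= g *^ a.
Proof.
rewrite /eq_elt; set w := some_wprod2 _ _ _; set h := wlift2 w f g.
have := reindex_le h (delta_subst E w a).
by rewrite reindexI -!reindex_comp wlift2_1 wlift2_2.
Qed.

Lemma eq_elt_pi (Z X : C) (f g f' g' : hom Z X) :
  eq_elt f g `&` eq_elt f f' `&` eq_elt g g' <= eq_elt f' g'.
Proof.
pose w := some_wprod2 (be_wfp E) X X.
pose u := some_wprod2 (be_wfp E) w w.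
pose t : hom u w := wlift2 w (wpr1 w \oc wpr1 u) (wpr1 w \oc wpr2 u).
pose t' : hom u w := wlift2 w (wpr2 w \oc wpr1 u) (wpr2 w \oc wpr2 u).
pose y : hom Z u := wlift2 u (wlift2 w f g) (wlift2 w f' g').
have := delta_pi E (w := w) (u := u) (t := t) (t' := t').
rewrite /t /t' !wlift2_1 !wlift2_2 -/t -/t' => /(_ erefl erefl erefl erefl).
move/(reindex_le y); rewrite !reindexI -!reindex_comp !eq_eltE !compA.
by rewrite /t /t' !wlift2_1 !wlift2_2 -!compA /y !(wlift2_1, wlift2_2).
Qed.

Lemma eq_elt_sym (Z X : C) (f g : hom Z X) : eq_elt f g <= eq_elt g f.
Proof.
have := eq_elt_pi f f g f.
by rewrite eq_elt_refl meet1x meetx1.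
Qed.

Lemma eq_elt_trans (Z X : C) (f g h : hom Z X) :
  eq_elt f g `&` eq_elt g h <= eq_elt f h.
Proof.
have := eq_elt_pi f g f h.
by rewrite eq_elt_refl meetx1.
Qed.

Definition eq_elts n (X : 'I_n -> C) Z (a b : forall i, hom Z (X i)) : P Z :=
  \meet_(i < n) eq_elt (a i) (b i).

Lemma eq_elts_le n (X : 'I_n -> C) Z (a b : forall i, hom Z (X i)) i :
  eq_elts a b <= eq_elt (a i) (b i).
Proof. exact: meets_inf. Qed.

Lemma eq_elts_refl n (X : 'I_n -> C) Z (a b : forall i, hom Z (X i)) :
  (forall i, a i = b i) -> eq_elts a b = \top.
Proof.
by move=> ab; rewrite /eq_elts big1 // => i _; rewrite ab eq_elt_refl.
Qed.

Lemma eq_elts_reindex n (X : 'I_n -> C) Y Z (k : hom Y Z)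
    (a b : forall i, hom Z (X i)) :
  k *^ eq_elts a b = eq_elts (fun i => a i \oc k) (fun i => b i \oc k).
Proof.
by rewrite reindex_meets; apply: eq_bigr => i _; rewrite eq_elt_reindex.
Qed.

Lemma proof_irrelevantP n (X : 'I_n -> C) (w : wprod X) (a : P w) :
  proof_irrelevant E a <->
  forall Z (h k : hom Z w),
    h *^ a `&` eq_elts (fun i => wproj w i \oc h) (fun i => wproj w i \oc k)
      <= k *^ a.
Proof.
split=> [[u [v [t [tE le_a]]]] Z h k | le_a].
  have := reindex_le (wlift2 u h k) le_a.
  rewrite reindexI reindex_meets -!reindex_comp wlift2_1 wlift2_2.
  congr (is_true (_ `&` _ <= _)); apply: eq_bigr => i _.
  rewrite -reindex_comp eq_eltE !compA; have [-> ->] := tE i.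
  by rewrite -!compA wlift2_1 wlift2_2.
pose u := some_wprod2 (be_wfp E) w w.
pose v i := some_wprod2 (be_wfp E) (X i) (X i).
exists u, v, (fun i => wlift2 (v i) (wproj w i \oc wpr1 u) (wproj w i \oc wpr2 u)).
split=> [i|]; first by rewrite wlift2_1 wlift2_2.
exact: le_a.
Qed.

(* The choice of weak products and arrows is immaterial. *)
Lemma proof_irrelevant_every n (X : 'I_n -> C) (w : wprod X) (a : P w)
    (u : wprod2 w w) (v : forall i, wprod2 (X i) (X i))
    (t : forall i, hom u (v i)) :
  proof_irrelevant E a ->
  (forall i, wpr1 (v i) \oc t i = wproj w i \oc wpr1 u /\
             wpr2 (v i) \oc t i = wproj w i \oc wpr2 u) ->
  wpr1 u *^ a `&` \meet_(i < n) (t i *^ delta E (v i)) <= wpr2 u *^ a.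
Proof.
move=> /proof_irrelevantP pi_a tE; have := pi_a _ (wpr1 u) (wpr2 u).
congr (is_true (_ `&` _ <= _)); apply: eq_bigr => i _.
by rewrite eq_eltE; have [-> ->] := tE i.
Qed.

Lemma proof_irrelevant_par n (X : 'I_n -> C) (w : wprod X) (a : P w) Z
    (h k : hom Z w) :
  proof_irrelevant E a -> (forall i, wproj w i \oc h = wproj w i \oc k) ->
  h *^ a = k *^ a.
Proof.
move=> /proof_irrelevantP pi_a hk; apply/eqP; rewrite eq_le.
have := pi_a _ h k; rewrite eq_elts_refl // meetx1 => -> /=.
by have := pi_a _ k h; rewrite eq_elts_refl // meetx1.
Qed.

Lemma proof_irrelevant_top n (X : 'I_n -> C) (w : wprod X) :
  proof_irrelevant E (\top : P w).
Proof. by apply/proof_irrelevantP => Z h k; rewrite !reindexT lex1. Qed.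

Lemma proof_irrelevant_meet n (X : 'I_n -> C) (w : wprod X) (a b : P w) :
  proof_irrelevant E a -> proof_irrelevant E b -> proof_irrelevant E (a `&` b).
Proof.
move=> /proof_irrelevantP pi_a /proof_irrelevantP pi_b.
apply/proof_irrelevantP => Z h k; rewrite !reindexI lexI; apply/andP; split.
  by apply: le_trans (pi_a Z h k); rewrite leI2 ?lexx ?leIl.
by apply: le_trans (pi_b Z h k); rewrite leI2 ?lexx ?leIr.
Qed.

(* Reindexing along an arrow induced by arrows [f j : X (s j) -> Y j] between
   the factors. *)
Lemma proof_irrelevant_reindex n m (X : 'I_n -> C) (Y : 'I_m -> C)
    (w : wprod X) (v : wprod Y) (s : 'I_m -> 'I_n)
    (f : forall j, hom (X (s j)) (Y j)) (g : hom w v) (a : P v) :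
  (forall j, wproj v j \oc g = f j \oc wproj w (s j)) ->
  proof_irrelevant E a -> proof_irrelevant E (g *^ a).
Proof.
move=> gE /proof_irrelevantP pi_a; apply/proof_irrelevantP => Z h k.
rewrite -!reindex_comp; apply: le_trans (pi_a Z (g \oc h) (g \oc k)).
apply: leI2 => //; apply/meetsP => j _; rewrite !compA gE -!compA.
exact: le_trans (eq_elts_le _ _ (s j)) (eq_elt_map _ _ _).
Qed.

Lemma proof_irrelevant_unary (X : C) (a : P X) :
  proof_irrelevant E (w := id_wprod X) a.
Proof.
apply/proof_irrelevantP => Z h k; apply: le_trans (eq_elt_subst h k a).
apply: leI2 => //; apply: le_trans (eq_elts_le _ _ ord0) _ => /=.
by rewrite !comp1m.
Qed.

Lemma proof_irrelevant_delta (X : C) (w : wprod (fun _ : 'I_2 => X)) :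
  proof_irrelevant E (delta E (wsquare_of w) : P w).
Proof.
apply/proof_irrelevantP => Z h k; rewrite !(eq_eltE (w := wsquare_of w)) /=.
apply: le_trans (eq_elt_pi _ _ _ _); rewrite -meetA; apply: leI2 => //.
rewrite lexI; apply/andP; split; first exact: (eq_elts_le _ _ ord0).
exact: (eq_elts_le _ _ ord_max).
Qed.

End EqElement.

(* The finite list [X_1, ..., X_n] is encoded by n and the family of the X_i. *)
Record flist (C : category) := FList { flen : nat; fnth : 'I_flen -> C }.

Arguments fnth {C} f i.

Record fhom (C : category) (L M : flist C) := FHom {
  fsel : 'I_(flen M) -> 'I_(flen L);
  farr : forall j, hom (fnth L (fsel j)) (fnth M j) }.

Arguments FHom {C L M} fsel farr.
Arguments fsel {C L M} f j.
Arguments farr {C L M} f j.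

Section ProductCompletion.
Context (C : category).

Definition fhom_id (L : flist C) : fhom L L := FHom id (fun j => idm (fnth L j)).

Definition fhom_comp (L M N : flist C) (g : fhom M N) (f : fhom L M) : fhom L N :=
  FHom (fun k => fsel f (fsel g k)) (fun k => farr g k \oc farr f (fsel g k)).

Fact fhom_ext (L M : flist C) s (f g : forall j, hom (fnth L (s j)) (fnth M j)) :
  (forall j, f j = g j) -> FHom s f = FHom s g.
Proof. by move=> fg; congr FHom; apply: functional_extensionality_dep. Qed.

Fact fhom_comp1m (L M : flist C) (f : fhom L M) : fhom_comp (fhom_id M) f = f.
Proof. by case: f => s f; apply: fhom_ext => j; rewrite comp1m. Qed.

Fact fhom_compm1 (L M : flist C) (f : fhom L M) : fhom_comp f (fhom_id L) = f.
Proof. by case: f => s f; apply: fhom_ext => j; rewrite compm1. Qed.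

Fact fhom_compA (L M N K : flist C) (h : fhom N K) (g : fhom M N) (f : fhom L M) :
  fhom_comp h (fhom_comp g f) = fhom_comp (fhom_comp h g) f.
Proof. by apply: fhom_ext => j; rewrite compA. Qed.

Definition product_completion : category :=
  Category fhom_comp1m fhom_compm1 fhom_compA.

(* The list [X, ..., X] with n entries. *)
Definition cpow (X : C) n : product_completion := @FList C n (fun=> X).

(* The arrow with components p_(s 0), ..., p_(s (m - 1)). *)
Definition cproj (X : C) n m (s : 'I_m -> 'I_n) : hom (cpow X n) (cpow X m) :=
  @FHom C (cpow X n) (cpow X m) s (fun=> idm X).

(* The arrow [f] x [g]. *)
Definition csquare (X Y : C) (f g : hom X Y) : hom (cpow X 2) (cpow Y 2) :=
  @FHom C (cpow X 2) (cpow Y 2) id (fun j => if j == ord0 then f else g).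

Definition csingle (X Y : C) (f : hom X Y) : hom (cpow X 1) (cpow Y 1) :=
  @FHom C (cpow X 1) (cpow Y 1) id (fun=> f).

(* [cproj (sel1 i)] is the projection p_i and [cproj (sel2 i j)] is the pairing
   <p_i, p_j>. *)
Definition sel1 n (i : 'I_n) : 'I_1 -> 'I_n := fun=> i.
Definition sel2 n (i j : 'I_n) : 'I_2 -> 'I_n :=
  fun k => if k == ord0 then i else j.

Definition cdiag (X : C) : hom (cpow X 1) (cpow X 2) :=
  cproj X (sel2 ord0 ord0).

Lemma cproj_comp (X : C) n m k (s : 'I_m -> 'I_n) (t : 'I_k -> 'I_m) :
  cproj X t \oc cproj X s = cproj X (fun i => s (t i)).
Proof. by apply: fhom_ext => i; rewrite comp1m. Qed.

Lemma cproj_csquare (X Y : C) (f g : hom X Y) (i : 'I_2) :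
  cproj Y (sel1 i) \oc csquare f g
    = csingle (if i == ord0 then f else g) \oc cproj X (sel1 i).
Proof. by apply: fhom_ext => j; rewrite comp1m compm1. Qed.

End ProductCompletion.

Variant point : Type := Point.
HB.instance Definition _ := gen_eqMixin point.
HB.instance Definition _ := gen_choiceMixin point.

Fact point_le_refl : reflexive (fun _ _ : point => true). Proof. by []. Qed.
Fact point_le_anti : antisymmetric (fun _ _ : point => true).
Proof. by case=> [] []. Qed.
Fact point_le_trans : transitive (fun _ _ : point => true). Proof. by []. Qed.
HB.instance Definition _ := Order.Le_isPOrder.Build (Order.Disp tt tt) point
  point_le_refl point_le_anti point_le_trans.
Fact point_lexI (x y z : point) : (x <= Point) = (x <= y) && (x <= z).
Proof. by []. Qed.
HB.instance Definition _ := Order.POrder_isMeetSemilattice.Build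
  (Order.Disp tt tt) point point_lexI.
Fact point_lex1 (x : point) : x <= Point. Proof. by []. Qed.
HB.instance Definition _ := Order.hasTop.Build (Order.Disp tt tt) point point_lex1.

Section Strictification.
Context (C : category) (P : doctrine C) (E : biased_elementary P).

Section Fiber.
Context (n : nat) (X : 'I_n -> C).

Record pi_elt := PiElt {
  pi_wprod : wprod X;
  pi_val : P pi_wprod;
  pi_valP : proof_irrelevant E pi_val }.

HB.instance Definition _ := gen_eqMixin pi_elt.
HB.instance Definition _ := gen_choiceMixin pi_elt.

Definition commutes (w v : wprod X) (h : hom w v) : Prop :=
  forall i, wproj v i \oc h = wproj w i.

Definition pi_eq (x y : pi_elt) : bool :=
  `[< exists h : hom (pi_wprod x) (pi_wprod y),
        commutes h /\ pi_val x = h *^ pi_val y >].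

Definition pi_le (x y : pi_elt) : bool :=
  `[< exists h : hom (pi_wprod x) (pi_wprod y),
        commutes h /\ pi_val x <= h *^ pi_val y >].

Definition pi_at (x : pi_elt) Z (a : forall i, hom Z (X i)) : P Z :=
  wlift (pi_wprod x) a *^ pi_val x.

Lemma pi_atE (x : pi_elt) Z (a : forall i, hom Z (X i)) (h : hom Z (pi_wprod x)) :
  (forall i, wproj (pi_wprod x) i \oc h = a i) -> h *^ pi_val x = pi_at x a.
Proof.
move=> hE; apply: proof_irrelevant_par (pi_valP x) _ => i.
by rewrite wliftE hE.
Qed.

Lemma reindex_pi_at (x : pi_elt) Y Z (k : hom Y Z) (a : forall i, hom Z (X i)) :
  k *^ pi_at x a = pi_at x (fun i => a i \oc k).
Proof. by rewrite -reindex_comp; apply: pi_atE => i; rewrite compA wliftE. Qed.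

Lemma pi_leP (x y : pi_elt) :
  reflect (forall Z (a : forall i, hom Z (X i)), pi_at x a <= pi_at y a)
          (pi_le x y).
Proof.
apply: (iffP (asboolP _)) => [[h [hE le_xy]] Z a | le_xy].
  have := reindex_le (wlift (pi_wprod x) a) le_xy.
  by rewrite -reindex_comp (pi_atE (x := y) (a := a)) // => i;
    rewrite compA hE wliftE.
exists (wlift (pi_wprod y) (wproj (pi_wprod x))); split.
  by move=> i; rewrite wliftE.
have := le_xy _ (wproj (pi_wprod x)).
rewrite -(pi_atE (x := x) (h := idm (pi_wprod x))) ?reindex_id // => i.
by rewrite compm1.
Qed.

Lemma pi_eqP (x y : pi_elt) :
  reflect (forall Z (a : forall i, hom Z (X i)), pi_at x a = pi_at y a)
          (pi_eq x y).
Proof.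
apply: (iffP (asboolP _)) => [[h [hE eq_xy]] Z a | eq_xy].
  rewrite {1}/pi_at eq_xy -reindex_comp; apply: pi_atE => i.
  by rewrite compA hE wliftE.
exists (wlift (pi_wprod y) (wproj (pi_wprod x))); split.
  by move=> i; rewrite wliftE.
have := eq_xy _ (wproj (pi_wprod x)).
rewrite -(pi_atE (x := x) (h := idm (pi_wprod x))) ?reindex_id // => i.
by rewrite compm1.
Qed.

Fact pi_eq_refl : reflexive pi_eq.
Proof. by move=> x; apply/pi_eqP. Qed.

Fact pi_eq_sym : symmetric pi_eq.
Proof. by move=> x y; apply/pi_eqP/pi_eqP => xy Z a; rewrite xy. Qed.

Fact pi_eq_trans : transitive pi_eq.
Proof.
by move=> y x z /pi_eqP xy /pi_eqP yz; apply/pi_eqP => Z a; rewrite xy yz.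
Qed.

Definition pi_equiv : equiv_rel pi_elt :=
  EquivRel pi_eq pi_eq_refl pi_eq_sym pi_eq_trans.

Definition pi_class := {eq_quot pi_equiv}.
HB.instance Definition _ := Choice.on pi_class.
HB.instance Definition _ := EqQuotient.on pi_class.

Definition pi_cls (w : wprod X) (a : P w) (pi_a : proof_irrelevant E a) :
  pi_class := \pi_pi_class (PiElt pi_a).

(* The reindexing of (a representative of) c along the lift of the legs a. *)
Definition cls_at (c : pi_class) Z (a : forall i, hom Z (X i)) : P Z :=
  pi_at (repr c) a.

Lemma cls_at_pi (x : pi_elt) Z (a : forall i, hom Z (X i)) :
  cls_at (\pi_pi_class x) a = pi_at x a.
Proof.
by move: Z a; apply/pi_eqP; rewrite -[pi_eq _ _]/(pi_equiv _ _) -eqmodE reprK.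
Qed.

Lemma cls_atE (w : wprod X) (b : P w) (pi_b : proof_irrelevant E b) Z
    (a : forall i, hom Z (X i)) (h : hom Z w) :
  (forall i, wproj w i \oc h = a i) -> cls_at (pi_cls pi_b) a = h *^ b.
Proof. by move=> hE; rewrite cls_at_pi -(pi_atE (x := PiElt pi_b) hE). Qed.

Lemma cls_ext (c d : pi_class) :
  (forall Z (a : forall i, hom Z (X i)), cls_at c a = cls_at d a) -> c = d.
Proof.
rewrite -[c]reprK -[d]reprK => cd; apply/eqmodP/pi_eqP => Z a.
by have := cd Z a; rewrite !cls_at_pi.
Qed.

Lemma reindex_cls_at (c : pi_class) Y Z (k : hom Y Z) (a : forall i, hom Z (X i)) :
  k *^ cls_at c a = cls_at c (fun i => a i \oc k).
Proof. exact: reindex_pi_at. Qed.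

Lemma cls_proof_irrelevant (c : pi_class) (w : wprod X) :
  proof_irrelevant E (cls_at c (wproj w)).
Proof.
apply: (proof_irrelevant_reindex (s := id) (f := fun i => idm (X i)))
  (pi_valP (repr c)) => i.
by rewrite wliftE comp1m.
Qed.

Definition cls_le (c d : pi_class) : bool := pi_le (repr c) (repr d).

Fact cls_le_refl : reflexive cls_le.
Proof. by move=> c; apply/pi_leP. Qed.

Fact cls_le_anti : antisymmetric cls_le.
Proof.
move=> c d /andP[/pi_leP cd /pi_leP dc]; apply: cls_ext => Z a.
by apply/eqP; rewrite eq_le /cls_at cd dc.
Qed.

Fact cls_le_trans : transitive cls_le.
Proof.
move=> d c e /pi_leP cd /pi_leP de; apply/pi_leP => Z a.
exact: le_trans (cd Z a) (de Z a).
Qed.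

HB.instance Definition _ := Order.Le_isPOrder.Build (Order.Disp tt tt) pi_class
  cls_le_refl cls_le_anti cls_le_trans.

Lemma cls_leP (c d : pi_class) :
  reflect (forall Z (a : forall i, hom Z (X i)), cls_at c a <= cls_at d a)
          (c <= d).
Proof. exact: pi_leP. Qed.

(* Both classes are represented on the weak product carrying [repr c]. *)
Definition cls_meet (c d : pi_class) : pi_class :=
  let w := pi_wprod (repr c) in
  pi_cls (proof_irrelevant_meet (cls_proof_irrelevant c w)
                                (cls_proof_irrelevant d w)).

Lemma cls_at_meet (c d : pi_class) Z (a : forall i, hom Z (X i)) :
  cls_at (cls_meet c d) a = cls_at c a `&` cls_at d a.
Proof.
set w := pi_wprod (repr c).
rewrite (cls_atE _ (h := wlift w a)); last by move=> i; rewrite wliftE.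
rewrite reindexI !reindex_cls_at.
have -> : (fun i => wproj w i \oc wlift w a) = a.
  by apply: functional_extensionality_dep => i; rewrite wliftE.
by [].
Qed.

Fact cls_lexI (c d e : pi_class) :
  (c <= cls_meet d e) = (c <= d) && (c <= e).
Proof.
apply/cls_leP/andP => [le_c | [/cls_leP cd /cls_leP ce] Z a].
  by split; apply/cls_leP => Z a; have := le_c Z a;
    rewrite cls_at_meet lexI => /andP[].
by rewrite cls_at_meet lexI cd ce.
Qed.

HB.instance Definition _ := Order.POrder_isMeetSemilattice.Build
  (Order.Disp tt tt) pi_class cls_lexI.

Definition cls_top : pi_class :=
  pi_cls (proof_irrelevant_top E (some_wprod (be_wfp E) X)).

Lemma cls_at_top Z (a : forall i, hom Z (X i)) : cls_at cls_top a = \top.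
Proof.
rewrite (cls_atE _ (h := wlift (some_wprod (be_wfp E) X) a)) ?reindexT // => i.
by rewrite wliftE.
Qed.

Fact cls_lex1 (c : pi_class) : c <= cls_top.
Proof. by apply/cls_leP => Z a; rewrite cls_at_top lex1. Qed.

HB.instance Definition _ := Order.hasTop.Build (Order.Disp tt tt) pi_class
  cls_lex1.

End Fiber.

Definition cls_infsl (L : flist C) : infsl := pi_class (fnth L).

Section Reindexing.
Context (L M : flist C) (f : fhom L M).

Definition cls_legs Z (a : forall i, hom Z (fnth L i)) (j : 'I_(flen M)) :
  hom Z (fnth M j) := farr f j \oc a (fsel f j).

Fact cls_reindex_subproof (c : cls_infsl M) (w : wprod (fnth L)) :
  proof_irrelevant E
    (wlift (pi_wprod (repr c)) (cls_legs (wproj w)) *^ pi_val (repr c)).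
Proof.
apply: (proof_irrelevant_reindex (s := fsel f) (f := farr f))
  (pi_valP (repr c)) => i.
by rewrite wliftE.
Qed.

Definition cls_reindex (c : cls_infsl M) : cls_infsl L :=
  pi_cls (cls_reindex_subproof c (some_wprod (be_wfp E) (fnth L))).

Lemma cls_at_reindex (c : cls_infsl M) Z (a : forall i, hom Z (fnth L i)) :
  cls_at (cls_reindex c) a = cls_at c (cls_legs a).
Proof.
set w := some_wprod (be_wfp E) (fnth L).
rewrite (cls_atE _ (h := wlift w a)); last by move=> i; rewrite wliftE.
rewrite -reindex_comp; apply: pi_atE => j.
by rewrite compA wliftE /cls_legs -compA wliftE.
Qed.

(* The value does not depend on the choices made in [cls_reindex]. *)
Lemma cls_reindexE (v : wprod (fnth M)) (b : P v) (pi_b : proof_irrelevant E b)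
    (w : wprod (fnth L)) (g : hom w v)
    (gE : forall j, wproj v j \oc g = farr f j \oc wproj w (fsel f j)) :
  cls_reindex (pi_cls pi_b) = pi_cls (proof_irrelevant_reindex gE pi_b).
Proof.
apply: cls_ext => Z a; rewrite cls_at_reindex.
have wE i : wproj w i \oc wlift w a = a i by rewrite wliftE.
rewrite (cls_atE _ wE) -reindex_comp; apply: cls_atE => j.
by rewrite compA gE -compA wE.
Qed.

Fact cls_reindexT : cls_reindex \top = \top.
Proof.
by apply: cls_ext => Z a; rewrite cls_at_reindex !cls_at_top.
Qed.

Fact cls_reindexI (c d : cls_infsl M) :
  cls_reindex (c `&` d) = cls_reindex c `&` cls_reindex d.
Proof.
by apply: cls_ext => Z a; rewrite cls_at_reindex !cls_at_meet !cls_at_reindex.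
Qed.

End Reindexing.

Fact cls_reindex_id (L : flist C) (c : cls_infsl L) :
  cls_reindex (fhom_id L) c = c.
Proof.
apply: cls_ext => Z a; rewrite cls_at_reindex; congr cls_at.
by apply: functional_extensionality_dep => j; rewrite /cls_legs /= comp1m.
Qed.

Fact cls_reindex_comp (L M N : flist C) (g : fhom M N) (f : fhom L M)
    (c : cls_infsl N) :
  cls_reindex (fhom_comp g f) c = cls_reindex f (cls_reindex g c).
Proof.
apply: cls_ext => Z a; rewrite !cls_at_reindex; congr cls_at.
by apply: functional_extensionality_dep => j; rewrite /cls_legs /= compA.
Qed.

Definition strict_fib (L : product_completion C) : infsl :=
  match flen L with 0 => point | _ => cls_infsl L end.

Definition strict_reindex (L M : product_completion C) (f : hom L M) :
    strict_fib M -> strict_fib L :=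
  match flen M as m, flen L as l return
    (match m with 0 => point | _ => cls_infsl M end : infsl) ->
    (match l with 0 => point | _ => cls_infsl L end : infsl)
  with
  | 0, _ => fun=> \top
  | _, 0 => fun=> Point
  | _, _ => cls_reindex f
  end.

Fact strict_reindexT (L M : product_completion C) (f : hom L M) :
  strict_reindex f \top = \top.
Proof.
case: L M f => [[|l] X] [[|m] Y] f //=.
exact: (cls_reindexT f).
Qed.

Fact strict_reindexI (L M : product_completion C) (f : hom L M)
    (a b : strict_fib M) :
  strict_reindex f (a `&` b) = strict_reindex f a `&` strict_reindex f b.
Proof.
case: L M f a b => [[|l] X] [[|m] Y] f a b //=.
- by rewrite /strict_reindex /= meetxx.
- exact: (cls_reindexI f a b).
Qed.

Fact strict_reindex_id (L : product_completion C) (a : strict_fib L) :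
  strict_reindex (idm L) a = a.
Proof.
case: L a => [[|l] X] a /=; first by case: a.
exact: (cls_reindex_id a).
Qed.

Fact strict_reindex_comp (L M N : product_completion C)
    (g : hom M N) (f : hom L M) (a : strict_fib N) :
  strict_reindex (g \oc f) a = strict_reindex f (strict_reindex g a).
Proof.
case: L M N g f a => [[|l] X] [[|m] Y] [[|p] Z] g f a //=.
- by case: (fsel g ord0).
- exact: (esym (cls_reindexT f)).
- exact: (cls_reindex_comp g f a).
Qed.

Definition strictification : doctrine (product_completion C) :=
  Doctrine strict_reindexT strict_reindexI strict_reindex_id strict_reindex_comp.

(* The identification P(X) = P^s[X]: an element of P(X) is placed on the unary
   weak product of X given by X itself and its identity. *)
Definition unary_cls (X : C) (a : P X) : strictification (cpow X 1) :=
  pi_cls (proof_irrelevant_unary E a).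

Definition delta_cls (X : C) : strictification (cpow X 2) :=
  pi_cls (proof_irrelevant_delta E (some_wprod (be_wfp E) (fun _ : 'I_2 => X))).

End Strictification.

Arguments delta_cls {C P} E X.
Arguments unary_cls {C P} E {X} a.

Section EquivalenceRelations.
Context (C : category) (P : doctrine C) (E : biased_elementary P).

Notation Ps := (strictification E).

Definition i30 : 'I_3 := @Ordinal 3 0 isT.
Definition i31 : 'I_3 := @Ordinal 3 1 isT.
Definition i32 : 'I_3 := @Ordinal 3 2 isT.

Record is_equiv_rel (X : C) (rho : Ps (cpow X 2)) : Prop := IsEquivRel {
  eqr_refl : \top <= cdiag X *^ rho;
  eqr_sym : cproj X (sel2 ord_max ord0) *^ rho <= rho;
  eqr_trans : cproj X (sel2 i30 i31) *^ rho `&` cproj X (sel2 i31 i32) *^ rho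
                <= cproj X (sel2 i30 i32) *^ rho }.

Definition descent (X : C) (rho : Ps (cpow X 2)) (a : P X) : bool :=
  cproj X (sel1 ord0) *^ unary_cls E a `&` rho
    <= cproj X (sel1 ord_max) *^ unary_cls E a.

(* The value of rho at a pair of generalized elements of X. *)
Definition rel_at (X : C) (rho : Ps (cpow X 2)) Z (a b : hom Z X) : P Z :=
  @cls_at _ _ E 2 (fun=> X) rho Z (fun i : 'I_2 => if i == ord0 then a else b).

Lemma ord2_fam (X : C) Z (a : 'I_2 -> hom Z X) :
  a = (fun i => if i == ord0 then a ord0 else a ord_max).
Proof.
apply: functional_extensionality_dep => i; case: eqP => [-> // | /eqP].
case: i => [[|[|m]] lt_i] //= _; congr a; exact: val_inj.
Qed.

Lemma rel_leP (X : C) (rho sigma : Ps (cpow X 2)) :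
  rho <= sigma <-> forall Z (a b : hom Z X), rel_at rho a b <= rel_at sigma a b.
Proof.
split=> [/cls_leP le_rs Z a b | le_rs]; first exact: le_rs.
by apply/cls_leP => Z a; rewrite (ord2_fam a); apply: le_rs.
Qed.

Lemma rel_at_csquare (X Y : C) (f g : hom X Y) (sigma : Ps (cpow Y 2)) Z
    (a b : hom Z X) :
  rel_at (csquare f g *^ sigma) a b = rel_at sigma (f \oc a) (g \oc b).
Proof.
rewrite /rel_at (@cls_at_reindex _ _ E (cpow X 2) (cpow Y 2) (csquare f g)).
congr cls_at; rewrite [LHS]ord2_fam; apply: functional_extensionality_dep => i.
by rewrite /cls_legs /=.
Qed.

Lemma reindex_rel_at (X : C) (rho : Ps (cpow X 2)) Y Z (k : hom Y Z)
    (a b : hom Z X) : k *^ rel_at rho a b = rel_at rho (a \oc k) (b \oc k).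
Proof.
rewrite /rel_at reindex_cls_at; congr cls_at.
by apply: functional_extensionality_dep => i; case: ifP.
Qed.

Lemma cls_at_cproj (X : C) n (s : 'I_2 -> 'I_n.+1) (rho : Ps (cpow X 2)) Z
    (a : 'I_n.+1 -> hom Z X) :
  @cls_at _ _ E n.+1 (fun=> X) (cproj X s *^ rho : Ps (cpow X n.+1)) Z a
    = rel_at rho (a (s ord0)) (a (s ord_max)).
Proof.
rewrite (@cls_at_reindex _ _ E (cpow X n.+1) (cpow X 2) (cproj X s)).
rewrite /rel_at; congr cls_at; rewrite [LHS]ord2_fam.
by apply: functional_extensionality_dep => i; rewrite /cls_legs /= !comp1m.
Qed.

Lemma is_equiv_relP (X : C) (rho : Ps (cpow X 2)) :
  is_equiv_rel rho <->
  [/\ forall Z (a : hom Z X), \top <= rel_at rho a a,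
      forall Z (a b : hom Z X), rel_at rho a b <= rel_at rho b a &
      forall Z (a b c : hom Z X),
        rel_at rho a b `&` rel_at rho b c <= rel_at rho a c].
Proof.
split=> [[/cls_leP refl /cls_leP sym /cls_leP trans] | [refl sym trans]].
  split=> [Z a | Z a b | Z a b c].
  - have := refl Z (fun=> a).
    by rewrite (@cls_at_cproj X 0) (@cls_at_top _ _ E 1).
  - have := sym Z (fun i => if i == ord0 then b else a).
    by rewrite (@cls_at_cproj X 1).
  - have := trans Z (fun i => if i == i30 then a else if i == i31 then b else c).
    rewrite (@cls_at_meet _ _ E 3).
    by rewrite !(@cls_at_cproj X 2).
split; apply/cls_leP => Z a.
- by rewrite (@cls_at_cproj X 0) (@cls_at_top _ _ E 1); apply: refl.
- rewrite (@cls_at_cproj X 1) /= [in leRHS](ord2_fam a); exact: sym.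
- by rewrite (@cls_at_meet _ _ E 3) !(@cls_at_cproj X 2); apply: trans.
Qed.

Lemma cls_at_unary (X : C) (a : P X) Z (f : 'I_1 -> hom Z X) :
  @cls_at _ _ E 1 (fun=> X) (unary_cls E a) Z f = f ord0 *^ a.
Proof. by apply: cls_atE => i; rewrite (ord1 i) comp1m. Qed.

Lemma descentP (X : C) (rho : Ps (cpow X 2)) (a : P X) :
  reflect (forall Z (f g : hom Z X), f *^ a `&` rel_at rho f g <= g *^ a)
          (descent rho a).
Proof.
have at_proj (i : 'I_2) Z (f : 'I_2 -> hom Z X) :
    @cls_at _ _ E 2 (fun=> X) (cproj X (sel1 i) *^ unary_cls E a : Ps (cpow X 2))
      Z f = f i *^ a.
  rewrite (@cls_at_reindex _ _ E (cpow X 2) (cpow X 1) (cproj X (sel1 i))).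
  by rewrite cls_at_unary /cls_legs /= comp1m.
apply: (iffP (cls_leP _ _)) => [des Z f g | des Z f].
  have := des Z (fun i => if i == ord0 then f else g).
  by rewrite (@cls_at_meet _ _ E 2) !at_proj.
rewrite (@cls_at_meet _ _ E 2) !at_proj; apply: le_trans (des _ _ _).
by apply: leI2 => //; rewrite /rel_at -ord2_fam.
Qed.

Lemma rel_at_delta (X : C) Z (a b : hom Z X) :
  rel_at (delta_cls E X) a b = eq_elt E a b.
Proof.
set w := some_wprod (be_wfp E) (fun _ : 'I_2 => X).
pose h := wlift w (fun i : 'I_2 => if i == ord0 then a else b).
rewrite /rel_at (cls_atE _ (h := h)); last by move=> i; rewrite wliftE.
by rewrite (eq_eltE E (w := wsquare_of w)) /= !wliftE.
Qed.

Fact delta_is_equiv_rel (X : C) : is_equiv_rel (delta_cls E X).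
Proof.
apply/is_equiv_relP; split=> *; rewrite !rel_at_delta.
- by rewrite eq_elt_refl.
- exact: eq_elt_sym.
- exact: eq_elt_trans.
Qed.

End EquivalenceRelations.

Section QuotientCompletion.
Context (C : category) (P : doctrine C) (E : biased_elementary P).

Record qobj := QObj {
  qcar : C;
  qrel : strictification E (cpow qcar 2);
  qrelP : is_equiv_rel qrel }.

Record qmor (A B : qobj) := QMor {
  qmap :> hom (qcar A) (qcar B);
  qmapP : qrel A <= csquare qmap qmap *^ qrel B }.

HB.instance Definition _ A B := gen_eqMixin (qmor A B).
HB.instance Definition _ A B := gen_choiceMixin (qmor A B).

Definition qmor_eq (A B : qobj) (f g : qmor A B) : bool :=
  qrel A <= csquare f g *^ qrel B.

Lemma qmor_eqP (A B : qobj) (f g : hom (qcar A) (qcar B)) :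
  qrel A <= csquare f g *^ qrel B <->
  forall Z (a b : hom Z (qcar A)),
    rel_at (qrel A) a b <= rel_at (qrel B) (f \oc a) (g \oc b).
Proof.
split=> [/rel_leP fg Z a b | fg]; first by rewrite -rel_at_csquare.
by apply/rel_leP => Z a b; rewrite rel_at_csquare.
Qed.

Lemma qrel_refl (A : qobj) Z (a : hom Z (qcar A)) : \top <= rel_at (qrel A) a a.
Proof. by have /is_equiv_relP[refl _ _] := qrelP A; apply: refl. Qed.

Lemma qrel_sym (A : qobj) Z (a b : hom Z (qcar A)) :
  rel_at (qrel A) a b <= rel_at (qrel A) b a.
Proof. by have /is_equiv_relP[_ sym _] := qrelP A; apply: sym. Qed.

Lemma qrel_trans (A : qobj) Z (a b c : hom Z (qcar A)) :
  rel_at (qrel A) a b `&` rel_at (qrel A) b c <= rel_at (qrel A) a c.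
Proof. by have /is_equiv_relP[_ _ trans] := qrelP A; apply: trans. Qed.

Lemma qmor_eqP1 (A B : qobj) (f g : qmor A B) :
  qmor_eq f g <->
  forall Z (a : hom Z (qcar A)), \top <= rel_at (qrel B) (f \oc a) (g \oc a).
Proof.
split=> [/qmor_eqP fg Z a | fg].
  exact: le_trans (qrel_refl a) (fg _ _ _).
apply/qmor_eqP => Z a b; apply: le_trans (qrel_trans _ (f \oc b) _).
rewrite lexI; apply/andP; split; last exact: le_trans (lex1 _) (fg _ _).
by have /qmor_eqP := qmapP f; apply.
Qed.

Fact qmor_eq_refl (A B : qobj) : reflexive (@qmor_eq A B).
Proof. by move=> f; apply: qmapP. Qed.

Fact qmor_eq_sym (A B : qobj) : symmetric (@qmor_eq A B).
Proof.
by move=> f g; apply/idP/idP => /qmor_eqP1 fg; apply/qmor_eqP1 => Z a;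
  apply: le_trans (fg Z a) (qrel_sym _ _).
Qed.

Fact qmor_eq_trans (A B : qobj) : transitive (@qmor_eq A B).
Proof.
move=> g f h /qmor_eqP1 fg /qmor_eqP1 gh; apply/qmor_eqP1 => Z a.
by apply: le_trans (qrel_trans _ (g \oc a) _); rewrite lexI fg gh.
Qed.

Definition qmor_equiv (A B : qobj) : equiv_rel (qmor A B) :=
  EquivRel (@qmor_eq A B) (@qmor_eq_refl A B) (@qmor_eq_sym A B)
    (@qmor_eq_trans A B).

Definition qhom (A B : qobj) : Type := {eq_quot qmor_equiv A B}.

Definition qclass (A B : qobj) (f : qmor A B) : qhom A B :=
  \pi_{eq_quot qmor_equiv A B} f.

Definition qrepr (A B : qobj) (f : qhom A B) : qmor A B :=
  repr (f : {eq_quot qmor_equiv A B}).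

Lemma qreprK (A B : qobj) (f : qhom A B) : qclass (qrepr f) = f.
Proof. exact: reprK. Qed.

Lemma qclass_eqP (A B : qobj) (f g : qmor A B) :
  qclass f = qclass g <-> qmor_eq f g.
Proof. exact: (rwP (@eqmodP _ (qmor_equiv A B) f g)). Qed.

Lemma qclassK (A B : qobj) (f : qmor A B) : qmor_eq (qrepr (qclass f)) f.
Proof. by apply/qclass_eqP; rewrite qreprK. Qed.

Fact qid_subproof (A : qobj) :
  qrel A <= csquare (idm (qcar A)) (idm (qcar A)) *^ qrel A.
Proof. by apply/qmor_eqP => Z a b; rewrite !comp1m. Qed.

Definition qmor_id (A : qobj) : qmor A A := QMor (qid_subproof A).

Fact qcomp_subproof (A B D : qobj) (g : qmor B D) (f : qmor A B) :
  qrel A <= csquare (g \oc f) (g \oc f) *^ qrel D.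
Proof.
apply/qmor_eqP => Z a b; rewrite -!compA.
have /qmor_eqP lef := qmapP f; have /qmor_eqP leg := qmapP g.
exact: le_trans (lef _ _ _) (leg _ _ _).
Qed.

Definition qmor_comp (A B D : qobj) (g : qmor B D) (f : qmor A B) : qmor A D :=
  QMor (qcomp_subproof g f).

Definition qid (A : qobj) : qhom A A := qclass (qmor_id A).

Definition qcomp (A B D : qobj) (g : qhom B D) (f : qhom A B) : qhom A D :=
  qclass (qmor_comp (qrepr g) (qrepr f)).

Lemma qcompE (A B D : qobj) (g : qmor B D) (f : qmor A B) :
  qcomp (qclass g) (qclass f) = qclass (qmor_comp g f).
Proof.
apply/qclass_eqP/qmor_eqP => Z a b /=; rewrite -!compA.
have /qmor_eqP lef := qclassK f; have /qmor_eqP leg := qclassK g.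
exact: le_trans (lef _ _ _) (leg _ _ _).
Qed.

Lemma qclass_ext (A B : qobj) (f g : qmor A B) :
  qmap f = qmap g -> qclass f = qclass g.
Proof. by move=> fg; apply/qclass_eqP; rewrite /qmor_eq -fg; apply: qmapP. Qed.

Fact qcomp1m (A B : qobj) (f : qhom A B) : qcomp (qid B) f = f.
Proof.
by rewrite -[f]qreprK qcompE; apply: qclass_ext; rewrite /= comp1m.
Qed.

Fact qcompm1 (A B : qobj) (f : qhom A B) : qcomp f (qid A) = f.
Proof.
by rewrite -[f]qreprK qcompE; apply: qclass_ext; rewrite /= compm1.
Qed.

Fact qcompA (A B D F : qobj) (h : qhom D F) (g : qhom B D) (f : qhom A B) :
  qcomp h (qcomp g f) = qcomp (qcomp h g) f.
Proof.
rewrite -[f]qreprK -[g]qreprK -[h]qreprK !qcompE; apply: qclass_ext => /=.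
by rewrite compA.
Qed.

Definition quotient_category : category := Category qcomp1m qcompm1 qcompA.

Definition des (A : qobj) : Type := {a : P (qcar A) | descent (qrel A) a}.

HB.instance Definition _ (A : qobj) := Choice.on (des A).

Definition des_le (A : qobj) (a b : des A) : bool := sval a <= sval b.

Fact des_le_refl (A : qobj) : reflexive (@des_le A).
Proof. by move=> a; apply: lexx. Qed.

Fact des_le_anti (A : qobj) : antisymmetric (@des_le A).
Proof. by move=> a b /le_anti ab; apply: val_inj. Qed.

Fact des_le_trans (A : qobj) : transitive (@des_le A).
Proof. by move=> b a c; apply: le_trans. Qed.

HB.instance Definition _ (A : qobj) := Order.Le_isPOrder.Build
  (Order.Disp tt tt) (des A) (@des_le_refl A) (@des_le_anti A) (@des_le_trans A).

Fact des_meet_subproof (A : qobj) (a b : des A) :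
  descent (qrel A) (sval a `&` sval b).
Proof.
case: a b => [a /descentP a_des] [b /descentP b_des] /=.
apply/descentP => Z f g; rewrite !reindexI lexI; apply/andP; split.
  by apply: le_trans (a_des Z f g); apply: leI2 => //; apply: leIl.
by apply: le_trans (b_des Z f g); apply: leI2 => //; apply: leIr.
Qed.

Definition des_meet (A : qobj) (a b : des A) : des A :=
  exist _ (sval a `&` sval b) (des_meet_subproof a b).

Fact des_lexI (A : qobj) (a b c : des A) :
  (a <= des_meet b c) = (a <= b) && (a <= c).
Proof. exact: lexI. Qed.

HB.instance Definition _ (A : qobj) := Order.POrder_isMeetSemilattice.Build
  (Order.Disp tt tt) (des A) (@des_lexI A).

Fact des_top_subproof (A : qobj) : descent (qrel A) \top.
Proof. by apply/descentP => Z f g; rewrite !reindexT lex1. Qed.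

Definition des_top (A : qobj) : des A := exist _ \top (des_top_subproof A).

Fact des_lex1 (A : qobj) (a : des A) : a <= des_top A.
Proof. exact: lex1. Qed.

HB.instance Definition _ (A : qobj) := Order.hasTop.Build
  (Order.Disp tt tt) (des A) (@des_lex1 A).

Fact qmor_des (A B : qobj) (f : qmor A B) (a : P (qcar B)) :
  descent (qrel B) a -> descent (qrel A) (qmap f *^ a).
Proof.
move=> /descentP a_des; apply/descentP => Z x y; rewrite -!reindex_comp.
apply: le_trans (a_des _ _ _); apply: leI2 => //.
by have /qmor_eqP := qmapP f; apply.
Qed.

Definition qreindex (A B : quotient_category) (f : hom A B) (a : des B) : des A :=
  exist _ (qmap (qrepr f) *^ sval a) (qmor_des (qrepr f) (svalP a)).

Lemma qreindexE (A B : qobj) (f : qmor A B) (a : des B) :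
  sval (qreindex (qclass f) a) = qmap f *^ sval a.
Proof.
have le (g h : qmor A B) : qmor_eq g h -> qmap g *^ sval a <= qmap h *^ sval a.
  move=> /qmor_eqP1 gh; have /descentP a_des := svalP a.
  apply: le_trans (a_des _ (qmap g) (qmap h)); rewrite lexI lexx /=.
  apply: le_trans (lex1 _) _; have := gh _ (idm _).
  by rewrite !compm1.
apply/eqP; rewrite eq_le; apply/andP; split; apply: le; first exact: qclassK.
by rewrite qmor_eq_sym; exact: qclassK.
Qed.

Fact qreindexT (A B : quotient_category) (f : hom A B) :
  qreindex f (\top : des B) = \top.
Proof. by apply: val_inj; exact: reindexT. Qed.

Fact qreindexI (A B : quotient_category) (f : hom A B) (a b : des B) :
  qreindex f (a `&` b) = qreindex f a `&` qreindex f b.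
Proof. by apply: val_inj; exact: reindexI. Qed.

Fact qreindex_id (A : quotient_category) (a : des A) : qreindex (idm A) a = a.
Proof.
apply: val_inj; apply: etrans (qreindexE (qmor_id A) a) _.
exact: reindex_id.
Qed.

Fact qreindex_comp (A B D : quotient_category) (g : hom B D) (f : hom A B)
    (a : des D) : qreindex (g \oc f) a = qreindex f (qreindex g a).
Proof.
apply: val_inj; apply: etrans (qreindexE (qmor_comp (qrepr g) (qrepr f)) a) _.
exact: reindex_comp.
Qed.

Definition quotient_doctrine : doctrine quotient_category :=
  @Doctrine quotient_category (fun A => des A : infsl) qreindex
    qreindexT qreindexI qreindex_id qreindex_comp.

(* The object (A, delta_[A]). *)
Definition discrete (A : C) : quotient_category :=
  QObj (delta_is_equiv_rel E A).

End QuotientCompletion.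

Arguments quotient_doctrine {C P} E.
Arguments discrete {C P} E A.

Section Slice.
Context (C : category) (B : C).

Record sobj := SObj { sdom : C; sarr : hom sdom B }.

Definition shom (x y : sobj) : Type :=
  {h : hom (sdom x) (sdom y) | sarr y \oc h = sarr x}.

Lemma shom_ext (x y : sobj) (f g : shom x y) : sval f = sval g -> f = g.
Proof. by case: f g => f fP [g gP] /= fg; exact: eq_exist. Qed.

Definition sid (x : sobj) : shom x x :=
  exist (fun h : hom (sdom x) (sdom x) => sarr x \oc h = sarr x)
    (idm (sdom x)) (compm1 (sarr x)).

Fact scomp_subproof (x y z : sobj) (g : shom y z) (f : shom x y) :
  sarr z \oc (sval g \oc sval f) = sarr x.
Proof. by rewrite compA (svalP g) (svalP f). Qed.

Definition scomp (x y z : sobj) (g : shom y z) (f : shom x y) : shom x z :=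
  exist (fun h : hom (sdom x) (sdom z) => sarr z \oc h = sarr x)
    (sval g \oc sval f) (scomp_subproof g f).

Fact scomp1m (x y : sobj) (f : shom x y) : scomp (sid y) f = f.
Proof. by apply: shom_ext; exact: comp1m. Qed.

Fact scompm1 (x y : sobj) (f : shom x y) : scomp f (sid x) = f.
Proof. by apply: shom_ext; exact: compm1. Qed.

Fact scompA (x y z t : sobj) (h : shom z t) (g : shom y z) (f : shom x y) :
  scomp h (scomp g f) = scomp (scomp h g) f.
Proof. by apply: shom_ext; exact: compA. Qed.

Definition slice_category : category := Category scomp1m scompm1 scompA.

Definition slice_doctrine (P : doctrine C) : doctrine slice_category :=
  @Doctrine slice_category (fun x : sobj => P (sdom x))
    (fun (x y : sobj) (h : shom x y) (a : P (sdom y)) => sval h *^ a)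
    (fun x y h => reindexT P (sval h))
    (fun x y h => @reindexI C P _ _ (sval h))
    (fun x => @reindex_id C P (sdom x))
    (fun x y z g f => @reindex_comp C P _ _ _ (sval g) (sval f)).

Lemma dfun_ordS n (T : 'I_n.+1 -> Type) (t0 : T ord0)
    (t : forall j, T (lift ord0 j)) :
  exists f : forall i, T i, f ord0 = t0 /\ forall j, f (lift ord0 j) = t j.
Proof.
have val i : {ti : T i | (forall e : i = ord0, eq_rect i T ti ord0 e = t0) /\
    forall j (e : i = lift ord0 j), eq_rect i T ti (lift ord0 j) e = t j}.
  case: (unliftP ord0 i) => [j ->|->].
    exists (t j); split=> [e|k e]; first by exfalso; have := neq_lift ord0 j; rewrite e eqxx.
    by have ek := lift_inj e; case: _ / ek e => e; rewrite (eq_axiomK e).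
  exists t0; split=> [e|k e]; first by rewrite (eq_axiomK e).
  by exfalso; have := neq_lift ord0 k; rewrite -e eqxx.
exists (fun i => sval (val i)); split=> [|j].
  exact: (svalP (val ord0)).1 erefl.
exact: (svalP (val (lift ord0 j))).2 j erefl.
Qed.

Lemma slice_weak_finite_products :
  has_weak_pullbacks C -> has_weak_finite_products slice_category.
Proof.
move=> wpb; elim=> [|n IHn] X.
  pose v : slice_category := SObj (idm B).
  have l (i : 'I_0) : hom v (X i) by case: i.
  constructor; exists v l => Z f; exists (exist (fun h : hom (sdom Z) B => idm B \oc h = sarr Z)
    (sarr Z) (comp1m (sarr Z))).
  by move=> i; exfalso; case: i.
have [w] := IHn (fun j => X (lift ord0 j)).
have [V [p [q [pq Vuniv]]]] := wpb _ _ _ (sarr (X ord0)) (sarr (wobj w)).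
pose v : slice_category := SObj (sarr (X ord0) \oc p).
pose p' : hom v (X ord0) := exist _ p erefl.
pose q' : hom v (wobj w) := exist _ q (esym pq).
have [l [l0 lS]] := dfun_ordS (T := fun i => hom v (X i)) p'
  (fun j => wproj w j \oc q').
constructor; exists v l => Z f.
have [k kE] := wprodP w (fun j => f (lift ord0 j)).
have [|h [h1 h2]] := Vuniv _ (sval (f ord0)) (sval k).
  by rewrite (svalP (f ord0)) (svalP k).
have hZ : sarr v \oc h = sarr Z by rewrite /= -compA h1 (svalP (f ord0)).
exists (exist _ h hZ) => i; case: (unliftP ord0 i) => [j ->|->].
  rewrite lS -kE -compA; congr (_ \oc _); exact: shom_ext.
by rewrite l0; apply: shom_ext.
Qed.

End Slice.

Section SliceElementary.
Context (C : category) (P : doctrine C) (E : biased_elementary P) (A : C).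
Context (wpb : has_weak_pullbacks C).

(* P_k delta^(p_1, p_2) for a weak product (p_1, p_2) of X and X and an arrow k
   with p_i k = pi_i. *)
Definition slice_delta (x : slice_category A) (w : wprod2 x x) :
    slice_doctrine A P w :=
  eq_elt E (sval (wpr1 w)) (sval (wpr2 w)).

Lemma slice_deltaE (x : slice_category A) (w : wprod2 x x)
    (v : wprod2 (sdom x) (sdom x)) (k : hom (sdom (wobj2 w)) v) :
  wpr1 v \oc k = sval (wpr1 w) -> wpr2 v \oc k = sval (wpr2 w) ->
  slice_delta w = k *^ delta E v.
Proof. by move=> k1 k2; rewrite eq_eltE k1 k2. Qed.

Fact slice_delta_refl (x : slice_category A) (w : wprod2 x x) (d : hom x w) :
  wpr1 w \oc d = idm x -> wpr2 w \oc d = idm x -> \top <= d *^ slice_delta w.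
Proof.
move=> /(congr1 sval) /= d1 /(congr1 sval) /= d2.
by rewrite /= eq_elt_reindex d1 d2 eq_elt_refl.
Qed.

Fact slice_delta_subst (x : slice_category A) (w : wprod2 x x)
    (a : slice_doctrine A P x) :
  wpr1 w *^ a `&` slice_delta w <= wpr2 w *^ a.
Proof. exact: (eq_elt_subst E (sval (wpr1 w)) (sval (wpr2 w)) a). Qed.

Fact slice_delta_nat (x x' : slice_category A) (w : wprod2 x x)
    (w' : wprod2 x' x') (f : hom x' x) (g : hom w' w) :
  wpr1 w \oc g = f \oc wpr1 w' -> wpr2 w \oc g = f \oc wpr2 w' ->
  slice_delta w' <= g *^ slice_delta w.
Proof.
move=> /(congr1 sval) /= g1 /(congr1 sval) /= g2.
by rewrite /= eq_elt_reindex g1 g2; exact: eq_elt_map.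
Qed.

Fact slice_delta_pi (x : slice_category A) (w : wprod2 x x) (u : wprod2 w w)
    (t t' : hom u w) :
  wpr1 w \oc t = wpr1 w \oc wpr1 u -> wpr2 w \oc t = wpr1 w \oc wpr2 u ->
  wpr1 w \oc t' = wpr2 w \oc wpr1 u -> wpr2 w \oc t' = wpr2 w \oc wpr2 u ->
  wpr1 u *^ slice_delta w `&` t *^ slice_delta w `&` t' *^ slice_delta w
    <= wpr2 u *^ slice_delta w.
Proof.
move=> /(congr1 sval) /= t1 /(congr1 sval) /= t2.
move=> /(congr1 sval) /= t'1 /(congr1 sval) /= t'2.
by rewrite /= !eq_elt_reindex t1 t2 t'1 t'2; exact: eq_elt_pi.
Qed.

Definition slice_elementary : biased_elementary (slice_doctrine A P) :=
  BiasedElementary (slice_weak_finite_products (B := A) wpb)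
    slice_delta_refl slice_delta_subst slice_delta_nat slice_delta_pi.

End SliceElementary.

Lemma weak_pullbacks (C : category) (P : doctrine C) (E : biased_elementary P) :
  weak_full_comprehensions P -> comprehensive_diagonals E ->
  has_weak_pullbacks C.
Proof.
move=> wfc cd X Y A f g.
pose w := some_wprod2 (be_wfp E) X Y.
have [K [c [[cT cuniv] _]]] := wfc w (eq_elt E (f \oc wpr1 w) (g \oc wpr2 w)).
exists K, (wpr1 w \oc c), (wpr2 w \oc c); split.
  apply/cd; pose v := some_wprod2 (be_wfp E) A A.
  exists v, (wlift2 v (f \oc (wpr1 w \oc c)) (g \oc (wpr2 w \oc c))).
  rewrite wlift2_1 wlift2_2; split=> //.
  by rewrite eq_eltE wlift2_1 wlift2_2 !compA -eq_elt_reindex.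
move=> Z a b fg; have [|h hE] := cuniv Z (wlift2 w a b).
  by rewrite eq_elt_reindex -!compA wlift2_1 wlift2_2 fg eq_elt_refl.
by exists h; rewrite -!compA -hE wlift2_1 wlift2_2.
Qed.

(* Main.v *)
(* Full comprehensions make an element of a fiber determined by the arrows k with
   top <= P_k a, and comprehensive diagonals make top <= eq(f, g) mean f = g.  So
   everything can be checked pointwise: a proof-irrelevant element over [X, X] is
   a relation on generalized elements of X.  Arrows (X, rho) -> (A, delta) are
   then plain arrows x : X -> A with rho contained in the kernel pair of x, while
   a slice equivalence relation over x is a relation on pairs (a, b) with
   x a = x b.  Restriction to the weak pullback of x along itself identifies the
   two; its inverse is the direct image along the comprehension of the kernel
   pair, computed with the existential quantifiers and equality. *)
From mathcomp Require Import all_boot all_order.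
From mathcomp Require Import boolp.
Require Import Defs.

Set Implicit Arguments.
Unset Strict Implicit.
Unset Printing Implicit Defensive.

Import Order.LTheory.
Local Open Scope order_scope.

(** * Comprehensions and diagonals expressed through points *)

Lemma inj_surj_bij (S T : Type) (f : S -> T) :
  injective f -> (forall y, exists x, f x = y) -> bijective f.
Proof.
move=> f_inj f_surj; pose g y := sval (cid (f_surj y)).
have gK : cancel g f by move=> y; exact: (svalP (cid (f_surj y))).
by exists g => // x; apply: f_inj; rewrite gK.
Qed.

Lemma le1I (L : infsl) (a b : L) :
  \top <= a `&` b <-> \top <= a /\ \top <= b.
Proof. by rewrite lexI; split=> [/andP|[-> ->]]. Qed.

(** The form in which full comprehensions are used; it passes directly to slices. *)
Definition separated_by_points (C : category) (P : doctrine C) : Prop :=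
  forall (X : C) (a b : P X),
    (forall K (k : hom K X), \top <= k *^ a -> \top <= k *^ b) -> a <= b.

Definition extensional_equality (C : category) (P : doctrine C)
    (E : biased_elementary P) : Prop :=
  forall (Z X : C) (f g : hom Z X), \top <= eq_elt E f g -> f = g.

(** By fullness, testing on the comprehension arrow of [a] alone suffices. *)
Lemma full_comprehensions_separated (C : category) (P : doctrine C) :
  weak_full_comprehensions P -> separated_by_points P.
Proof.
move=> wfc X a b ab; have [K [c [[cT _] full]]] := wfc X a.
exact/full/ab.
Qed.

Lemma comprehensive_diagonals_extensional (C : category) (P : doctrine C)
    (E : biased_elementary P) :
  comprehensive_diagonals E -> extensional_equality E.
Proof.
move=> cd Z X f g fg; apply/cd.
exists (some_wprod2 (be_wfp E) X X), (wlift2 _ f g).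
by rewrite wlift2_1 wlift2_2.
Qed.

(** * Relations and descent tested on points *)

Section Forcing.
Context (C : category) (P : doctrine C) (E : biased_elementary P).
Hypothesis sep : separated_by_points P.
Hypothesis ext : extensional_equality E.

(** Reindexing [rel_at rho a b] along [k] gives its value at [a \oc k] and [b \oc k], so separation
    reduces the inequality to pairs on which [rho] is true. *)
Lemma forced_rel_le (X Y : C) (rho : strictification E (cpow X 2))
    (sigma : strictification E (cpow Y 2)) (f g : hom X Y) :
  (forall Z (a b : hom Z X), \top <= rel_at rho a b ->
     \top <= rel_at sigma (f \oc a) (g \oc b)) ->
  forall Z (a b : hom Z X), rel_at rho a b <= rel_at sigma (f \oc a) (g \oc b).
Proof.
move=> rs Z a b; apply: sep => K k.
by rewrite !reindex_rel_at -!compA; apply: rs.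
Qed.

Lemma forced_rel_ext (X : C) (rho sigma : strictification E (cpow X 2)) :
  (forall Z (a b : hom Z X), \top <= rel_at rho a b <-> \top <= rel_at sigma a b) ->
  rho = sigma.
Proof.
move=> rs; apply/le_anti/andP; split; apply/rel_leP => Z a b; apply: sep => K k;
  by rewrite !reindex_rel_at => /rs.
Qed.

Lemma forced_equiv_rel (X : C) (rho : strictification E (cpow X 2)) :
  (forall Z (a : hom Z X), \top <= rel_at rho a a) ->
  (forall Z (a b : hom Z X), \top <= rel_at rho a b -> \top <= rel_at rho b a) ->
  (forall Z (a b c : hom Z X), \top <= rel_at rho a b -> \top <= rel_at rho b c ->
     \top <= rel_at rho a c) ->
  is_equiv_rel rho.
Proof.
move=> refl sym trans; apply/is_equiv_relP; split=> // [Z a b | Z a b c];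
  apply: sep => K k.
- by rewrite !reindex_rel_at; apply: sym.
- by rewrite reindexI !reindex_rel_at => /le1I[]; apply: trans.
Qed.

Lemma forced_descent (X : C) (rho : strictification E (cpow X 2)) (a : P X) :
  (forall Z (f g : hom Z X), \top <= f *^ a -> \top <= rel_at rho f g ->
     \top <= g *^ a) ->
  descent rho a.
Proof.
move=> des; apply/descentP => Z f g; apply: sep => K k.
rewrite reindexI reindex_rel_at -!(reindex_comp _ _ a) => /le1I[]; exact: des.
Qed.

Lemma descent_forced (X : C) (rho : strictification E (cpow X 2)) (a : P X) :
  descent rho a ->
  forall Z (f g : hom Z X), \top <= f *^ a -> \top <= rel_at rho f g ->
     \top <= g *^ a.
Proof.
move=> /descentP des Z f g fa fg; apply: le_trans (des Z f g).
exact/le1I.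
Qed.

Lemma forced_eq_elts n (X : 'I_n -> C) Z (a b : forall i, hom Z (X i)) :
  \top <= eq_elts E a b -> forall i, a i = b i.
Proof. by move=> ab i; apply: ext; apply: le_trans ab (eq_elts_le _ _ _ i). Qed.

(** At a point where [eq_elts] is true the legs are equal as arrows, so only lifts with the same
    legs need comparing. *)
Lemma forced_proof_irrelevant n (X : 'I_n -> C) (w : wprod X) (a : P w) :
  (forall Z (h k : hom Z w), (forall i, wproj w i \oc h = wproj w i \oc k) ->
     \top <= h *^ a -> \top <= k *^ a) ->
  proof_irrelevant E a.
Proof.
move=> par; apply/proof_irrelevantP => Z h k; apply: sep => K j.
rewrite reindexI eq_elts_reindex -!(reindex_comp _ _ a) => /le1I[ha /forced_eq_elts hk].
by apply: par ha => i; rewrite !compA.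
Qed.

(** A Yoneda argument: [rho] is the value of [r] at the two projections of a weak square. Lifts are
    not unique, but naturality makes reindexing this value depend on the legs only, which gives
    proof-irrelevance. *)
Lemma natural_family_rel (X : C) (r : forall Z, hom Z X -> hom Z X -> P Z) :
  (forall Y Z (k : hom Y Z) a b, k *^ r Z a b = r Y (a \oc k) (b \oc k)) ->
  exists rho : strictification E (cpow X 2),
    forall Z (a b : hom Z X), rel_at rho a b = r Z a b.
Proof.
move=> nat_r; pose w := some_wprod (be_wfp E) (fun _ : 'I_2 => X).
have pi_r : proof_irrelevant E (r w (wproj w ord0) (wproj w ord_max)).
  by apply: forced_proof_irrelevant => Z h k hk; rewrite !nat_r !hk.
exists (pi_cls pi_r) => Z a b; rewrite /rel_at.
set f := (fun i : 'I_2 => if i == ord0 then a else b); rewrite (cls_atE _ (h := wlift w f)).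
  by rewrite nat_r !wliftE.
by move=> i; rewrite wliftE.
Qed.

End Forcing.

(** * Points and relations in the slice *)

Section SliceForcing.
Context (C : category) (P : doctrine C) (E : biased_elementary P) (A : C).
Context (wpb : has_weak_pullbacks C).

Notation EA := (slice_elementary E A wpb).

(** The structure map [z] is a parameter so that two arrows agreeing over [A] can be given literally
    the same source in the slice. *)
Definition slice_arrow (x : slice_category A) Z (z : hom Z A)
    (a : hom Z (sdom x)) (az : sarr x \oc a = z) :
    hom (SObj z : slice_category A) x :=
  exist (fun h => sarr x \oc h = z) a az.

Lemma slice_separated :
  separated_by_points P -> separated_by_points (slice_doctrine A P).
Proof.
move=> sep x a b ab; apply: sep => K k.
exact: ab _ (slice_arrow (erefl (sarr x \oc k))).
Qed.

Lemma slice_eq_elt (z x : slice_category A) (f g : hom z x) :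
  eq_elt EA f g = eq_elt E (sval f) (sval g).
Proof.
rewrite {1}/eq_elt; set w := some_wprod2 _ _ _.
rewrite /= /slice_delta eq_elt_reindex.
have /(congr1 sval) /= -> := wlift2_1 w f g.
by have /(congr1 sval) /= -> := wlift2_2 w f g.
Qed.

Lemma slice_extensional : extensional_equality E -> extensional_equality EA.
Proof.
by move=> ext z x f g fg; apply/shom_ext/ext; rewrite -slice_eq_elt.
Qed.

Hypothesis sep : separated_by_points P.
Hypothesis ext : extensional_equality E.

Lemma slice_restrict_exists (x : slice_category A)
    (rho : strictification E (cpow (sdom x) 2)) :
  exists sigma : strictification EA (cpow x 2),
    forall z (a b : hom z x), rel_at sigma a b = rel_at rho (sval a) (sval b).
Proof.
apply: (natural_family_rel (slice_separated sep) (slice_extensional ext)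
  (r := fun z (a b : hom z x) => rel_at rho (sval a) (sval b))).
by move=> y z k a b; rewrite /= reindex_rel_at.
Qed.

(** Arrows [a] and [b] lift to a common source over [A] only if they agree after [sarr x];
    quantifying over [z] includes this condition without a dependent proof. *)
Definition slice_holds (x : slice_category A)
    (sigma : strictification EA (cpow x 2)) Z (a b : hom Z (sdom x)) : Prop :=
  exists z (a' b' : hom (SObj z : slice_category A) x),
    [/\ sval a' = a, sval b' = b & \top <= rel_at sigma a' b'].

(** The witnesses are unique: [z] must be [sarr x] composed with [a], and a slice arrow is
    determined by its underlying arrow. *)
Lemma slice_holdsP (x z : slice_category A)
    (sigma : strictification EA (cpow x 2)) (a b : hom z x) :
  slice_holds sigma (sval a) (sval b) <-> \top <= rel_at sigma a b.
Proof.
split=> [| ab].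
  case: z a b => Z z a b [z' [a' [b' [aE bE ab]]]].
  have zE : z' = z.
    exact: etrans (esym (svalP a')) (etrans (congr1 (comp (sarr x)) aE) (svalP a)).
  by case: _ / zE a b aE bE => a b /shom_ext <- /shom_ext <-.
by case: z a b ab => Z z a b ab; exists z, a, b.
Qed.

(* The family [r] of the proof says of (a, b) that some v in the weak pullback [V]
   of x along itself lies over (a, b) and satisfies sigma; weak Beck-Chevalley
   makes it natural. *)
Lemma slice_extend_exists (x : slice_category A)
    (sigma : strictification EA (cpow x 2)) :
  existential E ->
  exists rho : strictification E (cpow (sdom x) 2),
    forall Z (a b : hom Z (sdom x)),
      \top <= rel_at rho a b <-> slice_holds sigma a b.
Proof.
move=> [ex1 [ex2 ex]].
pose w := some_wprod2 (be_wfp EA) x x; pose V := sdom (wobj2 w).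
pose p1 : hom V (sdom x) := sval (wpr1 w); pose p2 : hom V (sdom x) := sval (wpr2 w).
pose beta : P V := rel_at sigma (wpr1 w) (wpr2 w).
have p1A : sarr x \oc p1 = sarr (wobj2 w) by exact: (svalP (wpr1 w)).
have p2A : sarr x \oc p2 = sarr (wobj2 w) by exact: (svalP (wpr2 w)).
have betaE (z : slice_category A) (h : hom z w) :
    sval h *^ beta = rel_at sigma (wpr1 w \oc h) (wpr2 w \oc h).
  exact: (reindex_rel_at sigma h (wpr1 w) (wpr2 w)).
pose U Z := some_wprod2 (be_wfp E) V Z.
pose s Z (a b : hom Z (sdom x)) : P (U Z) := wpr1 (U Z) *^ beta `&`
  (eq_elt E (p1 \oc wpr1 (U Z)) (a \oc wpr2 (U Z)) `&`
   eq_elt E (p2 \oc wpr1 (U Z)) (b \oc wpr2 (U Z))).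
pose r Z (a b : hom Z (sdom x)) : P Z := ex2 _ _ (U Z) (s Z a b).
have sE Z a b K (k : hom K (U Z)) : k *^ s Z a b =
    (wpr1 (U Z) \oc k) *^ beta `&`
    (eq_elt E (p1 \oc (wpr1 (U Z) \oc k)) (a \oc (wpr2 (U Z) \oc k)) `&`
     eq_elt E (p2 \oc (wpr1 (U Z) \oc k)) (b \oc (wpr2 (U Z) \oc k))).
  by rewrite /s !reindexI !eq_elt_reindex -reindex_comp !compA.
have sP Z a b K (k : hom K (U Z)) : \top <= k *^ s Z a b ->
    [/\ \top <= (wpr1 (U Z) \oc k) *^ beta,
        p1 \oc (wpr1 (U Z) \oc k) = a \oc (wpr2 (U Z) \oc k) &
        p2 \oc (wpr1 (U Z) \oc k) = b \oc (wpr2 (U Z) \oc k)].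
  by rewrite sE => /le1I[? /le1I[? ?]]; split=> //; apply: ext.
(* Weak Beck-Chevalley requires proof-irrelevance. By [sE], reindexing [s] along [k] sees only the
   composites of [k] with the two projections. *)
have pi_s Z a b : proof_irrelevant2 E (s Z a b).
  apply: forced_proof_irrelevant => // Y h k hk; rewrite !sE.
  by have := hk ord0; have := hk ord_max; rewrite /= => -> ->.
have nat_r Y Z (k : hom Y Z) a b : k *^ r Z a b = r Y (a \oc k) (b \oc k).
  pose k' := wlift2 (U Z) (wpr1 (U Y)) (k \oc wpr2 (U Y)).
  rewrite -(ex2_BC ex (f' := k') (v := U Y)) ?wlift2_1 ?wlift2_2 //.
  by rewrite sE wlift2_1 wlift2_2 !compA.
have [rho rhoE] := natural_family_rel sep ext nat_r.
exists rho => Z a b; rewrite rhoE; split=> [rab | [z [a' [b' [aE bE]]]]].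
  (* The equation holds at every point of [s], since [p1] and [p2] agree over [A]. The adjunction
     transfers it to [r], and extensionality makes it an equality of arrows. *)
  have xab : sarr x \oc a = sarr x \oc b.
    apply: ext; apply: le_trans rab _; apply/(ex2_adj ex); apply: sep => K k.
    case/sP => _ ka kb; rewrite -reindex_comp eq_elt_reindex -!compA.
    by rewrite -ka -kb !compA p1A p2A eq_elt_refl.
  pose a' := slice_arrow (erefl (sarr x \oc a)); pose b' := slice_arrow (esym xab).
  exists (sarr x \oc a), a', b'; split=> //; pose m := wlift2 w a' b'.
  have -> : rel_at sigma a' b' = sval m *^ beta.
    by rewrite betaE wlift2_1 wlift2_2.
  apply: le_trans rab _; apply/(ex2_adj ex); apply: sep => K k.
  case/sP => kbeta ka kb.
  have m1 : p1 \oc sval m = a by have /(congr1 sval) := wlift2_1 w a' b'.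
  have m2 : p2 \oc sval m = b by have /(congr1 sval) := wlift2_2 w a' b'.
  rewrite -!(reindex_comp _ _ beta).
  (* The witness [wpr1 (U Z) \oc k] and the composite through [m] may differ as arrows into the weak
     pullback. As slice arrows with one source they have the same legs, which is all that [beta]
     sees. *)
  pose k1 := slice_arrow (erefl (sarr (wobj2 w) \oc (wpr1 (U Z) \oc k))).
  have k2A : sarr (wobj2 w) \oc (sval m \oc (wpr2 (U Z) \oc k))
      = sarr (wobj2 w) \oc (wpr1 (U Z) \oc k).
    by move: (sval m) m1 => n m1; rewrite -p1A -!compA ka [p1 \oc _]compA m1.
  pose k2 := slice_arrow k2A.
  rewrite -compA -[_ *^ beta]/(sval k2 *^ beta) betaE.
  have {kbeta}: \top <= rel_at sigma (wpr1 w \oc k1) (wpr2 w \oc k1).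
    by rewrite -betaE.
  have -> : wpr1 w \oc k2 = wpr1 w \oc k1.
    by apply: shom_ext => /=; rewrite -/p1 ka compA m1.
  have -> // : wpr2 w \oc k2 = wpr2 w \oc k1.
  by apply: shom_ext => /=; rewrite -/p2 kb compA m2.
move=> ab; pose m := wlift2 w a' b'.
have m1 : p1 \oc sval m = a by have /(congr1 sval) := wlift2_1 w a' b'; rewrite aE.
have m2 : p2 \oc sval m = b by have /(congr1 sval) := wlift2_2 w a' b'; rewrite bE.
(* A section of the projection to [Z] whose first leg is the witness [m]: the unit of the
   adjunction, pulled back along it, bounds [r] from below. *)
pose t := wlift2 (U Z) (sval m) (idm Z).
have : t *^ s Z a b <= t *^ (wpr2 (U Z) *^ r Z a b).
  by apply: reindex_le; apply/(ex2_adj ex).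
rewrite -reindex_comp sE wlift2_1 wlift2_2 reindex_id m1 m2 !compm1.
rewrite !eq_elt_refl !meetx1; apply: le_trans.
by rewrite betaE wlift2_1 wlift2_2.
Qed.

End SliceForcing.

(** * Extension and restriction of relations along the slice *)

Section Comparison.
Context (C : category) (P : doctrine C) (E : biased_elementary P) (A : C).
Context (wpb : has_weak_pullbacks C).
Hypothesis Hex : existential E.
Hypothesis sep : separated_by_points P.
Hypothesis ext : extensional_equality E.

Notation EA := (slice_elementary E A wpb).
Notation Q := (quotient_doctrine E).
Notation QA := (quotient_doctrine EA).

Lemma qobj_ext (D : category) (R : doctrine D) (F : biased_elementary R) (X : D)
    (rho sigma : strictification F (cpow X 2))
    (rhoP : is_equiv_rel rho) (sigmaP : is_equiv_rel sigma) :
  rho = sigma -> QObj rhoP = QObj sigmaP.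
Proof.
by move=> eq_rs; case: _ / eq_rs sigmaP => sigmaP; congr QObj; apply: Prop_irrelevance.
Qed.

Lemma forced_qmorP (X Y : qobj E) (f g : hom (qcar X) (qcar Y)) :
  qrel X <= csquare f g *^ qrel Y <->
  forall Z (a b : hom Z (qcar X)), \top <= rel_at (qrel X) a b ->
    \top <= rel_at (qrel Y) (f \oc a) (g \oc b).
Proof.
split=> [/qmor_eqP le_fg Z a b ab|fg]; first exact: le_trans ab (le_fg _ _ _).
exact/qmor_eqP/forced_rel_le.
Qed.

(** Evaluation at the identity of [X] makes [eq_elt] of the two maps true, so an arrow into the
    discrete object has only one representing map. *)
Lemma discrete_class_inj (X : qobj E) (f g : qmor X (discrete E A)) :
  qclass f = qclass g -> qmap f = qmap g.
Proof.
move=> /qclass_eqP/qmor_eqP1/(_ _ (idm _)); rewrite !compm1 rel_at_delta.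
exact: ext.
Qed.

(** Obtained by choice, yet determined by [slice_extendP]: relations true on the same pairs are
    equal. *)
Definition slice_extend (x : slice_category A)
    (sigma : strictification EA (cpow x 2)) : strictification E (cpow (sdom x) 2) :=
  sval (cid (slice_extend_exists sep ext sigma Hex)).

Lemma slice_extendP (x : slice_category A)
    (sigma : strictification EA (cpow x 2)) Z (a b : hom Z (sdom x)) :
  \top <= rel_at (slice_extend sigma) a b <-> slice_holds sigma a b.
Proof. exact: (svalP (cid (slice_extend_exists sep ext sigma Hex))). Qed.

Lemma slice_extend_at (x z : slice_category A)
    (sigma : strictification EA (cpow x 2)) (a b : hom z x) :
  \top <= rel_at (slice_extend sigma) (sval a) (sval b) <->
  \top <= rel_at sigma a b.
Proof. by rewrite slice_extendP slice_holdsP. Qed.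

Lemma slice_extend_over (x : slice_category A)
    (sigma : strictification EA (cpow x 2)) Z (a b : hom Z (sdom x)) :
  \top <= rel_at (slice_extend sigma) a b -> sarr x \oc a = sarr x \oc b.
Proof.
move=> /slice_extendP[z [a' [b' [<- <- _]]]].
by rewrite (svalP a') (svalP b').
Qed.

Definition slice_restrict (x : slice_category A)
    (rho : strictification E (cpow (sdom x) 2)) : strictification EA (cpow x 2) :=
  sval (cid (slice_restrict_exists wpb sep ext rho)).

Lemma slice_restrict_at (x : slice_category A)
    (rho : strictification E (cpow (sdom x) 2)) z (a b : hom z x) :
  rel_at (slice_restrict rho) a b = rel_at rho (sval a) (sval b).
Proof. exact: (svalP (cid (slice_restrict_exists wpb sep ext rho))). Qed.

Lemma slice_extendK (x : slice_category A)
    (sigma : strictification EA (cpow x 2)) :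
  slice_restrict (slice_extend sigma) = sigma.
Proof.
apply: (forced_rel_ext (slice_separated sep)) => z a b.
by rewrite slice_restrict_at slice_extend_at.
Qed.

(** Restriction keeps only the pairs that agree over [A]; by hypothesis [rho] is true on no
    others. *)
Lemma slice_restrictK (x : slice_category A)
    (rho : strictification E (cpow (sdom x) 2)) :
  (forall Z (a b : hom Z (sdom x)), \top <= rel_at rho a b ->
     sarr x \oc a = sarr x \oc b) ->
  slice_extend (slice_restrict rho) = rho.
Proof.
move=> over; apply: (forced_rel_ext sep) => Z a b; rewrite slice_extendP.
split=> [[z [a' [b' [<- <-]]]] | ab]; first by rewrite slice_restrict_at.
exists (sarr x \oc a), (slice_arrow (erefl (sarr x \oc a))), (slice_arrow (esym (over _ _ _ ab))).
by split; rewrite ?slice_restrict_at.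
Qed.

Lemma slice_extend_equiv_rel (x : slice_category A)
    (sigma : strictification EA (cpow x 2)) :
  is_equiv_rel sigma -> is_equiv_rel (slice_extend sigma).
Proof.
move=> /is_equiv_relP[refl sym trans].
apply: forced_equiv_rel => // [Z a | Z a b | Z a b c].
- pose a' := slice_arrow (erefl (sarr x \oc a)).
  apply/slice_extendP; exists (sarr x \oc a), a', a'.
  by split=> //; apply: refl.
- case/slice_extendP=> z [a' [b' [<- <- ab]]].
  by apply/(slice_extend_at sigma b' a'); apply: le_trans ab (sym _ _ _).
- case/slice_extendP=> z [a' [b' [<- <- ab]]] bc.
  (* Transitivity in the slice needs [c] over the same [z] as [a'] and [b']. *)
  have cA : sarr x \oc c = z by rewrite -(slice_extend_over bc) (svalP b').
  pose c' := slice_arrow cA.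
  apply/(slice_extend_at sigma a' c'); apply: le_trans (trans _ a' b' c').
  by apply/le1I; split=> //; exact: (slice_extend_at sigma b' c').1 bc.
Qed.

Lemma slice_restrict_equiv_rel (x : slice_category A)
    (rho : strictification E (cpow (sdom x) 2)) :
  is_equiv_rel rho -> is_equiv_rel (slice_restrict rho).
Proof.
move=> /is_equiv_relP[refl sym trans]; apply/is_equiv_relP.
split=> [z a | z a b | z a b c]; rewrite !slice_restrict_at.
- exact: refl.
- exact: sym.
- exact: trans.
Qed.

(** * The comparison on objects *)

Definition total_qobj (X : qobj EA) : qobj E :=
  QObj (slice_extend_equiv_rel (qrelP X)).

Fact structure_qmor_subproof (X : qobj EA) :
  qrel (total_qobj X) <=
    csquare (sarr (qcar X)) (sarr (qcar X)) *^ qrel (discrete E A).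
Proof.
apply/(forced_qmorP (Y := discrete E A)) => Z a b /slice_extend_over ab.
by rewrite rel_at_delta ab eq_elt_refl.
Qed.

Definition structure_qmor (X : qobj EA) : qmor (total_qobj X) (discrete E A) :=
  @QMor _ _ _ (total_qobj X) (discrete E A) (sarr (qcar X))
    (structure_qmor_subproof X).

Definition to_slice_obj (X : quotient_category EA) :
    slice_category (discrete E A) :=
  SObj (qclass (structure_qmor X) : hom (total_qobj X : quotient_category E) _).

Definition base_sobj (y : slice_category (discrete E A)) : slice_category A :=
  SObj (qmap (qrepr (sarr y))).

Definition of_slice_obj (y : slice_category (discrete E A)) :
    quotient_category EA :=
  @QObj _ _ EA (base_sobj y) _
    (@slice_restrict_equiv_rel (base_sobj y) _ (qrelP (sdom y))).

(** The round trip returns the structure map as a chosen representative, equal to the original only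
    propositionally. Keeping [x] and [rho] variable lets the equations be eliminated despite the
    types depending on them. *)
Lemma of_slice_objE (X : qobj EA) (x : hom (sdom (qcar X)) A)
    (rho : strictification E (cpow (sdom (qcar X)) 2))
    (rhoP : is_equiv_rel (slice_restrict (x := SObj x) rho)) :
  x = sarr (qcar X) -> rho = slice_extend (qrel X) -> QObj rhoP = X.
Proof.
case: X x rho rhoP => [[X x] sigma sigmaP] x' rho rhoP /= xE.
case: _ / (esym xE) rhoP => rhoP rhoE; apply: qobj_ext; rewrite rhoE.
exact: slice_extendK.
Qed.

Lemma to_slice_objK : cancel to_slice_obj of_slice_obj.
Proof.
move=> X; apply: of_slice_objE => //.
exact: (discrete_class_inj (qreprK (qclass (structure_qmor X)))).
Qed.

(** The same device for the other round trip; equal maps have equal classes, so the structure arrow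
    is recovered. *)
Lemma to_slice_objE (X : qobj E) (f : hom (X : quotient_category E) (discrete E A))
   (rho : strictification E (cpow (qcar X) 2)) (rhoP : is_equiv_rel rho)
   (g : qmor (QObj rhoP) (discrete E A)) :
  rho = qrel X -> qmap g = qmap (qrepr f) ->
  SObj (qclass g : hom (QObj rhoP : quotient_category E) _) = SObj f.
Proof.
case: X f rho rhoP g => [X sigma sigmaP] f rho rhoP g /= rhoE.
case: _ / (esym rhoE) rhoP g => rhoP g gE.
have eqP := Prop_irrelevance rhoP sigmaP; case: _ / (esym eqP) g gE => g gE.
apply: (congr1 (@SObj (quotient_category E) _ (QObj sigmaP))).
rewrite -[RHS]qreprK.
exact: (@qclass_ext _ _ _ (QObj sigmaP) (discrete E A) _ (qrepr f)).
Qed.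

Lemma of_slice_objK : cancel of_slice_obj to_slice_obj.
Proof.
move=> [X f]; apply: to_slice_objE => //=.
apply: (@slice_restrictK (base_sobj (SObj f))) => Z a b /=.
(* An arrow into the discrete object sends related pairs to equal arrows, which is the condition of
   [slice_restrictK]. *)
have /(forced_qmorP (Y := discrete E A)) := qmapP (qrepr f).
by move=> /(_ Z a b) fP /fP; rewrite rel_at_delta; exact: ext.
Qed.

(** * The comparison on arrows *)

Fact total_qmor_subproof (X Y : qobj EA) (f : qmor X Y) :
  qrel (total_qobj X) <=
    csquare (sval (qmap f)) (sval (qmap f)) *^ qrel (total_qobj Y).
Proof.
apply/(@forced_qmorP (total_qobj X) (total_qobj Y)) => Z a b.
case/slice_extendP=> z [a' [b' [<- <- ab]]].
apply/(slice_extend_at (qrel Y) (qmap f \oc a') (qmap f \oc b')).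
by have /qmor_eqP le_f := qmapP f; apply: le_trans ab (le_f _ _ _).
Qed.

Definition total_qmor (X Y : qobj EA) (f : qmor X Y) :
  qmor (total_qobj X) (total_qobj Y) :=
  @QMor _ _ _ (total_qobj X) (total_qobj Y) (sval (qmap f)) (total_qmor_subproof f).

(** From right to left this makes the functor well defined on classes, from left to right faithful.
    Any arrow into the carrier becomes a slice arrow by composing with the structure map. *)
Lemma total_qmor_eq (X Y : qobj EA) (f g : qmor X Y) :
  qmor_eq (total_qmor f) (total_qmor g) <-> qmor_eq f g.
Proof.
split=> /qmor_eqP1 fg; apply/qmor_eqP1.
  move=> z a; apply/(slice_extend_at (qrel Y) (qmap f \oc a) (qmap g \oc a)).
  exact: fg.
move=> Z a; pose a' := slice_arrow (erefl (sarr (qcar X) \oc a)).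
apply/(slice_extend_at (qrel Y) (qmap f \oc a') (qmap g \oc a')); exact: fg.
Qed.

Fact to_slice_hom_subproof (X Y : qobj EA) (f : qhom X Y) :
  qcomp (qclass (structure_qmor Y)) (qclass (total_qmor (qrepr f)))
    = qclass (structure_qmor X).
Proof.
by rewrite qcompE; apply: qclass_ext; exact: (svalP (qmap (qrepr f))).
Qed.

Definition to_slice_hom (X Y : quotient_category EA) (f : hom X Y) :
    hom (to_slice_obj X) (to_slice_obj Y) :=
  exist (fun h => qcomp (qclass (structure_qmor Y)) h = qclass (structure_qmor X))
    (qclass (total_qmor (qrepr f))) (to_slice_hom_subproof f).

Lemma to_slice_homE (X Y : qobj EA) (f : qmor X Y) :
  sval (to_slice_hom (qclass f)) = qclass (total_qmor f).
Proof. by apply/qclass_eqP/total_qmor_eq/qclassK. Qed.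

Fact to_slice_hom_id (X : quotient_category EA) :
  to_slice_hom (idm X) = idm (to_slice_obj X).
Proof.
apply: shom_ext; rewrite (to_slice_homE (qmor_id X)).
exact: qclass_ext.
Qed.

Fact to_slice_hom_comp (X Y Z : quotient_category EA) (g : hom Y Z) (f : hom X Y) :
  to_slice_hom (g \oc f) = to_slice_hom g \oc to_slice_hom f.
Proof.
apply: shom_ext.
rewrite (to_slice_homE (qmor_comp (qrepr g) (qrepr f))) [RHS]/= qcompE.
exact: qclass_ext.
Qed.

Definition to_slice : functor (quotient_category EA)
    (slice_category (discrete E A)) :=
  Functor to_slice_hom_id to_slice_hom_comp.

Lemma to_slice_hom_inj (X Y : quotient_category EA) :
  injective (@to_slice_hom X Y).
Proof.
move=> f g /(congr1 sval)/qclass_eqP/total_qmor_eq/qclass_eqP.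
by rewrite !qreprK.
Qed.

Lemma to_slice_hom_surj (X Y : quotient_category EA)
    (h : hom (to_slice_obj X) (to_slice_obj Y)) :
  exists f : hom X Y, to_slice_hom f = h.
Proof.
(* The triangle over the discrete object commutes between classes, hence on representatives, so the
   map underlying [h] is an arrow of the slice. *)
have hA : sarr (qcar Y) \oc qmap (qrepr (sval h)) = sarr (qcar X).
  have := svalP h; rewrite /= -[sval h]qreprK qcompE qreprK.
  exact: discrete_class_inj.
pose k : hom (qcar X) (qcar Y) := exist _ (qmap (qrepr (sval h))) hA.
have kP : qrel X <= csquare k k *^ qrel Y.
  apply/qmor_eqP/(forced_rel_le (slice_separated sep)) => z a b.
  move/(slice_extend_at (qrel X)) => ab.
  apply/(slice_extend_at (qrel Y) (k \oc a) (k \oc b)).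
  by have /forced_qmorP := qmapP (qrepr (sval h)); apply.
exists (qclass (QMor kP)); apply: shom_ext.
by rewrite to_slice_homE -[sval h]qreprK; apply: qclass_ext.
Qed.

Lemma to_slice_iso : cat_iso to_slice.
Proof.
split; first by exists of_slice_obj; [exact: to_slice_objK | exact: of_slice_objK].
move=> X Y; apply: inj_surj_bij; first exact: to_slice_hom_inj.
exact: to_slice_hom_surj.
Qed.

(** * The comparison on fibers *)

Lemma total_descent (X : qobj EA) (a : P (sdom (qcar X))) :
  descent (qrel (total_qobj X)) a = descent (E := EA) (qrel X) a.
Proof.
(* The pairs on which the extended relation is true are those underlying related slice arrows, so
   both conditions test the same instances. *)
apply/idP/idP => [|] des.
  apply: (forced_descent (slice_separated sep)) => z f g fa.
  move/(slice_extend_at (qrel X)); exact: (descent_forced des).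
apply: (forced_descent sep) => Z f g fa /slice_extendP[z [f' [g' [fE gE fg]]]].
rewrite -fE -gE in fa *; exact: (descent_forced des (f := f') (g := g')).
Qed.

Definition to_slice_des (X : quotient_category EA) (a : QA X) :
    slice_doctrine (discrete E A) Q (to_slice X) :=
  exist _ (sval a) (etrans (total_descent _) (svalP a)).

Lemma to_slice_des_iso (X : quotient_category EA) : infsl_iso (@to_slice_des X).
Proof.
split; [|exact: val_inj|by move=> a b; exact: val_inj].
apply: inj_surj_bij => [a b /(congr1 sval) ab|b]; first exact: val_inj.
exists (exist _ (sval b) (etrans (esym (total_descent _)) (svalP b))).
exact: val_inj.
Qed.

(** The class of [total_qmor (qrepr f)] may have another chosen representative; reindexing descent
    data does not depend on it. *)
Lemma to_slice_des_natural (X Y : quotient_category EA) (f : hom X Y) (a : QA Y) :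
  to_slice_des (f *^ a) = fmap to_slice f *^ to_slice_des a.
Proof.
apply: val_inj.
exact: esym (qreindexE (total_qmor (qrepr f)) (to_slice_des a)).
Qed.

End Comparison.

Theorem proposition6p19 (C : category) (P : doctrine C)
    (E : biased_elementary P)
    (Hex : existential E)
    (Hcomp : weak_full_comprehensions P)
    (Hdiag : comprehensive_diagonals E)
    (A : C) :
  doctrine_iso
    (quotient_doctrine (slice_elementary E A (weak_pullbacks Hcomp Hdiag)))
    (slice_doctrine (discrete E A) (quotient_doctrine E)).
Proof.
have sep := full_comprehensions_separated Hcomp.
have ext := comprehensive_diagonals_extensional Hdiag.
pose wpb := weak_pullbacks Hcomp Hdiag.
exists (@to_slice C P E A wpb Hex sep ext), (@to_slice_des C P E A wpb Hex sep ext).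
by split; [exact: to_slice_iso | exact: to_slice_des_iso | exact: to_slice_des_natural].
Qed.
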